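(* Let $X=(X_2\rightrightarrows\mathcal C_{X_1})$ be any generating data. 1. $\mathcal A_X$ has the following universal property: there is a canonical inclusion $\iota_A:X\to\mathcal A_X$ of 2-categorically graded sets, and for any 2-category $\mathcal B$ with an inclusion $\iota_B:X\to\mathcal B$ (in $gr_2Cat$) such that $(\iota_B)_{|\mathcal C_{X_1}}$ is a map in $p_2Cat$, there is a unique map of 2-categories $F:\mathcal A_X\to\mathcal B$ such that $\iota_B=F\iota_A$. 2. If $X$ is generating data and $C$ is a binary relation on $\mathcal A_X$, then there exists a 2-category $\mathcal A_{X/C}$ satisfying: (a) there is a map of 2-categories $G:\mathcal A_X\to\mathcal A_{X/C}$ such that $xCy$ implies $Gx=Gy$; and (b) any other map $F:\mathcal A_X\to\mathcal B$ of 2-categories such that $xCy$ implies $Fx=Fy$ factors uniquely through $G$. 3. Any 2-category has a presentation in terms of generators and relations, i.e. any 2-category $\mathcal B$ is isomorphic to some $\mathcal A_{X/C}$ (a 2-category with the universal property of part 2) for some generating data $X$ and some binary relation $C$ on $\mathcal A_X$.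
   Context: Everything is small. For $n\ge 0$, an *$n$-categorically graded set* is a set $S$ with maps $s_i,t_i : S \to S$ for $0\le i<n$ such that, whenever $\sigma_i,\rho_i \in \{s_i,t_i\}$: (i) $\rho_i\sigma_i = \sigma_i$ for all $i$; (ii) for all $i<j$ and $\sigma_i\in\{s_i,t_i\}$, $\rho_j\in\{s_j,t_j\}$, $\rho_j\sigma_i=\sigma_i$ and $\sigma_i\rho_j=\sigma_i$. Morphisms are functions preserving all $s_i,t_i$; this gives the category $gr_nCat$. The set of $i$-morphisms of $\mathcal A$ is $\mathcal A_i:=s_i\mathcal A=t_i\mathcal A$ (a $k$-morphism is identified with the identity $(k+1)$-morphism on it). An inclusion is a map injective on underlying sets. A *pre-$n$-category* is an $n$-categorically graded set $\mathcal A$ together with compositions $*_i : \{(a,b)\in\mathcal A\times\mathcal A : s_i a = t_i b\}\to\mathcal A$ for $0\le i\le n-1$ such that $s_i(a*_i b)=s_i b$, $t_i(a*_i b)=t_i a$, and for $i<j$ and $\rho_j\in\{s_j,t_j\}$, $\rho_j(a*_i b)=\rho_j a *_i \rho_j b$. (No associativity, unit or interchange laws are required.) Morphisms are functions preserving all $s_i,t_i,*_i$; this gives the category $p_nCat$. A pre-1-category is regarded as a pre-2-category by letting $s_1=t_1=\mathrm{id}$ (so that necessarily $x*_1x=x$). A *2-category* here means a bicategory: a pre-2-category $\mathcal A$ with 2-isomorphisms $\alpha_{h,g,f}:(h*_0g)*_0f\Rightarrow h*_0(g*_0f)$ for all composable $f,g,h\in\mathcal A_1$, $\lambda_f:t_0f*_0f\Rightarrow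 f$ and $\rho_f:f*_0s_0f\Rightarrow f$ for all $f\in\mathcal A_1$, satisfying the usual bicategory axioms (coherence conditions): $*_1$ is strictly associative and unital ($a*_1s_1a=a=t_1a*_1a$), the interchange law between $*_0$ and $*_1$, naturality of $\alpha,\lambda,\rho$, and the pentagon and triangle identities. A *map of 2-categories* is a morphism of pre-2-categories (so strictly preserving sources, targets and both compositions) which preserves the $\alpha$'s, $\lambda$'s and $\rho$'s. *Free pre-1-category.* For $X_1\in gr_1Cat$, $\mathcal C_{X_1}\in p_1Cat$ is the pre-1-category of fully parenthesized composable formal words in $X_1$: $S_1=X_1$, $S_n=\bigsqcup_{1\le p\le n-1}\{x\bullet_0 y : x\in S_p,\ y\in S_{n-p},\ s_0x=t_0y\}$, $\mathcal C_{X_1}=\bigsqcup_{n\ge1}S_n$, with $s_0(x\bullet_0y)=s_0y$, $t_0(x\bullet_0y)=t_0x$ and $x*_0y=x\bullet_0y$. *Generating data* $X=(X_1,X_2\rightrightarrows\mathcal C_{X_1})$ consists of $X_1\in gr_1Cat$ and a set $X_2$ with maps of sets $s_1,t_1:X_2\to\mathcal C_{X_1}$ such that $\sigma_0s_1=\sigma_0t_1$ for $\sigma_0\in\{s_0,t_0\}$. Write $\mathcal C=\mathcal C_{X_1}$. As a 2-categorically graded set, $X$ denotes the disjoint union $X_2\cup\mathcal C$, with $s_1=t_1=\mathrm{id}$ on $\mathcal C$ and $\sigma_0:=\sigma_0s_1$ on $X_2$. *The pre-2-category $\mathcal F_X$ generated by $X$* is $\bigsqcup_{n\ge1}T_n$,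 where $T_1=X_2\sqcup\mathcal C$, $T_2$ is the set of formal words $x\bullet_iy$ with $i\in\{0,1\}$, $x,y\in T_1$, $s_ix=t_iy$, excluding words $x\bullet_0y$ with $x,y\in\mathcal C$, and for $n>2$, $T_n=\bigsqcup_{0<p<n}\{x\bullet_iy: i\in\{0,1\}, x\in T_p,y\in T_{n-p},s_ix=t_iy\}$. Its structure is $s_i(x\bullet_iy)=s_iy$, $t_i(x\bullet_iy)=t_ix$, $s_0(x\bullet_1y)=s_0y$, $t_0(x\bullet_1y)=t_0x$, $\sigma_1(x\bullet_0y)=\sigma_1x*_0\sigma_1y$ for $\sigma_1\in\{s_1,t_1\}$; $x*_1y=x\bullet_1y$; and $x*_0y$ is the composite in $\mathcal C$ if $x,y\in\mathcal C$, and $x\bullet_0y$ otherwise. *The 2-category $\mathcal A_X$ generated by $X$* (with no conditions) is the 2-category, unique up to isomorphism, equipped with a map $G_0:\mathcal F_X\to\mathcal A_X$ in $p_2Cat$ such that for every 2-category $D$ and every map $F:\mathcal F_X\to D$ in $p_2Cat$ there is a unique map of 2-categories $H:\mathcal A_X\to D$ with $HG_0=F$. The canonical map $\iota_A$ is the composite $X\hookrightarrow\mathcal F_X\xrightarrow{G_0}\mathcal A_X$. *)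

(* Defs.v *)
From mathcomp Require Import all_boot.
From mathcomp Require Import boolp.

Set Implicit Arguments.
Unset Strict Implicit.
Unset Printing Implicit Defensive.

(* [bd Src i] and [bd Tgt i] are the maps s_i and t_i; quantifying over a side
   expresses "whenever sigma_i is one of s_i, t_i". *)
Variant side := Src | Tgt.

Record grCat (n : nat) := GrCat {
  gr_sort :> Type;
  bd : side -> 'I_n -> gr_sort -> gr_sort;
  bd_idem : forall (d e : side) (i : 'I_n) (x : gr_sort),
    bd d i (bd e i x) = bd e i x;
  bd_upper : forall (d e : side) (i j : 'I_n) (x : gr_sort), i < j ->
    bd d j (bd e i x) = bd e i x;
  bd_lower : forall (d e : side) (i j : 'I_n) (x : gr_sort), i < j ->
    bd e i (bd d j x) = bd e i x
}.
Arguments bd {n g} e i x : rename.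

Notation src := (bd Src).
Notation tgt := (bd Tgt).

Definition is_mor n (A : grCat n) (i : 'I_n) (x : A) : Prop :=
  exists y : A, x = src i y.

Definition is_gr_map n (A B : grCat n) (f : A -> B) : Prop :=
  forall (e : side) (i : 'I_n) (x : A), f (bd e i x) = bd e i (f x).

(* The partial composition *_i is encoded by a total function [comp i]: its
   values on pairs with [src i a <> tgt i b] are arbitrary, and neither the
   axioms nor the notion of map ever refer to them.  The same convention is
   used below for the constraint cells of a bicategory. *)
Record preCat (n : nat) := PreCat {
  pre_gr :> grCat n;
  comp : 'I_n -> pre_gr -> pre_gr -> pre_gr;
  comp_src : forall (i : 'I_n) (a b : pre_gr), src i a = tgt i b ->
    src i (comp i a b) = src i b;
  comp_tgt : forall (i : 'I_n) (a b : pre_gr), src i a = tgt i b ->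
    tgt i (comp i a b) = tgt i a;
  comp_bd : forall (e : side) (i j : 'I_n) (a b : pre_gr), i < j ->
    src i a = tgt i b ->
    bd e j (comp i a b) = comp i (bd e j a) (bd e j b)
}.
Arguments comp {n p} i a b : rename.

Definition is_pre_map n (A B : preCat n) (f : A -> B) : Prop :=
  is_gr_map f /\
  forall (i : 'I_n) (a b : A), src i a = tgt i b ->
    f (comp i a b) = comp i (f a) (f b).

Notation i0 := (@ord0 1).
Notation i1 := (@ord_max 1).
Notation "a **0 b" := (comp i0 a b) (at level 40, left associativity).
Notation "a **1 b" := (comp i1 a b) (at level 40, left associativity).

Lemma ordI2 (i : 'I_2) : i = i0 \/ i = i1.
Proof.
by case: i => [[|[|k]] Hk] //; [left|right]; apply: val_inj.
Qed.

Section PreOneAsPreTwo.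
Variable A : preCat 1.

Definition pre12_bd (e : side) (i : 'I_2) (x : A) : A :=
  if i == i0 then bd e ord0 x else x.

Lemma pre12_idem d e i x : pre12_bd d i (pre12_bd e i x) = pre12_bd e i x.
Proof. by rewrite /pre12_bd; case: (i == i0); rewrite ?bd_idem. Qed.

Lemma pre12_upper d e (i j : 'I_2) x : i < j ->
  pre12_bd d j (pre12_bd e i x) = pre12_bd e i x.
Proof. by case: (ordI2 i) (ordI2 j) => -> [] ->. Qed.

Lemma pre12_lower d e (i j : 'I_2) x : i < j ->
  pre12_bd e i (pre12_bd d j x) = pre12_bd e i x.
Proof. by case: (ordI2 i) (ordI2 j) => -> [] ->. Qed.

Definition gr12 : grCat 2 := GrCat pre12_idem pre12_upper pre12_lower.

(* For i = 1 the composable pairs are the pairs (x, x), and x *_1 x = x. *)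
Definition pre12_comp (i : 'I_2) (a b : gr12) : gr12 :=
  if i == i0 then comp ord0 (a : A) (b : A) else a.

Lemma pre12_src i (a b : gr12) : src i a = tgt i b ->
  src i (pre12_comp i a b) = src i b.
Proof. by case: (ordI2 i) => ->; [apply: comp_src|]. Qed.

Lemma pre12_tgt i (a b : gr12) : src i a = tgt i b ->
  tgt i (pre12_comp i a b) = tgt i a.
Proof. by case: (ordI2 i) => ->; [apply: comp_tgt|]. Qed.

Lemma pre12_comp_bd e (i j : 'I_2) (a b : gr12) : i < j ->
  src i a = tgt i b ->
  bd e j (pre12_comp i a b) = pre12_comp i (bd e j a) (bd e j b).
Proof. by case: (ordI2 i) (ordI2 j) => -> [] ->. Qed.

Definition pre12 : preCat 2 := PreCat pre12_src pre12_tgt pre12_comp_bd.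
End PreOneAsPreTwo.

Definition is_iso2 (A : preCat 2) (a : A) : Prop :=
  exists b : A, [/\ src i1 b = tgt i1 a, tgt i1 b = src i1 a,
                    b **1 a = src i1 a & a **1 b = tgt i1 a].

(* 1-morphisms are identified with their identity 2-morphisms, so for instance
   [k **0 alpha h g f] is the whiskering of [alpha h g f] by the 1-morphism k. *)
Record bicat := Bicat {
  bc_pre :> preCat 2;
  alpha : bc_pre -> bc_pre -> bc_pre -> bc_pre;
  lambda : bc_pre -> bc_pre;
  rho : bc_pre -> bc_pre;

  alpha_bd : forall h g f : bc_pre,
    is_mor i1 h -> is_mor i1 g -> is_mor i1 f ->
    src i0 h = tgt i0 g -> src i0 g = tgt i0 f ->
    [/\ src i1 (alpha h g f) = (h **0 g) **0 f,
        tgt i1 (alpha h g f) = h **0 (g **0 f)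
      & is_iso2 (alpha h g f)];
  lambda_bd : forall f : bc_pre, is_mor i1 f ->
    [/\ src i1 (lambda f) = tgt i0 f **0 f,
        tgt i1 (lambda f) = f
      & is_iso2 (lambda f)];
  rho_bd : forall f : bc_pre, is_mor i1 f ->
    [/\ src i1 (rho f) = f **0 src i0 f,
        tgt i1 (rho f) = f
      & is_iso2 (rho f)];

  comp1A : forall a b c : bc_pre,
    src i1 a = tgt i1 b -> src i1 b = tgt i1 c ->
    (a **1 b) **1 c = a **1 (b **1 c);
  comp1_src : forall a : bc_pre, a **1 src i1 a = a;
  comp1_tgt : forall a : bc_pre, tgt i1 a **1 a = a;

  interchange : forall a b c d : bc_pre,
    src i1 a = tgt i1 b -> src i1 c = tgt i1 d -> src i0 a = tgt i0 c ->
    (a **1 b) **0 (c **1 d) = (a **0 c) **1 (b **0 d);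

  alpha_nat : forall c b a : bc_pre,
    src i0 c = tgt i0 b -> src i0 b = tgt i0 a ->
    alpha (tgt i1 c) (tgt i1 b) (tgt i1 a) **1 ((c **0 b) **0 a) =
    (c **0 (b **0 a)) **1 alpha (src i1 c) (src i1 b) (src i1 a);
  lambda_nat : forall a : bc_pre,
    lambda (tgt i1 a) **1 (tgt i0 a **0 a) = a **1 lambda (src i1 a);
  rho_nat : forall a : bc_pre,
    rho (tgt i1 a) **1 (a **0 src i0 a) = a **1 rho (src i1 a);

  pentagon : forall k h g f : bc_pre,
    is_mor i1 k -> is_mor i1 h -> is_mor i1 g -> is_mor i1 f ->
    src i0 k = tgt i0 h -> src i0 h = tgt i0 g -> src i0 g = tgt i0 f ->
    alpha k h (g **0 f) **1 alpha (k **0 h) g f =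
    (k **0 alpha h g f) **1 (alpha k (h **0 g) f **1 (alpha k h g **0 f));
  triangle : forall g f : bc_pre,
    is_mor i1 g -> is_mor i1 f -> src i0 g = tgt i0 f ->
    (g **0 lambda f) **1 alpha g (src i0 g) f = rho g **0 f
}.
Arguments alpha {b} h g f : rename.
Arguments lambda {b} f : rename.
Arguments rho {b} f : rename.

Definition is_bicat_map (A B : bicat) (F : A -> B) : Prop :=
  [/\ is_pre_map F,
      forall h g f : A,
        is_mor i1 h -> is_mor i1 g -> is_mor i1 f ->
        src i0 h = tgt i0 g -> src i0 g = tgt i0 f ->
        F (alpha h g f) = alpha (F h) (F g) (F f),
      forall f : A, is_mor i1 f -> F (lambda f) = lambda (F f)
    & forall f : A, is_mor i1 f -> F (rho f) = rho (F f)].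

Definition bicat_iso (A B : bicat) : Prop :=
  exists (F : A -> B) (H : B -> A),
    [/\ is_bicat_map F, is_bicat_map H, cancel F H & cancel H F].

(* The inductive type is the disjoint union over n of the words of length n. *)
Inductive word (T : Type) := WGen of T | WBul of word T & word T.
Arguments WGen {T} _.
Arguments WBul {T} _ _.

Section FreePreOne.
Variable X1 : grCat 1.

Fixpoint wbd (e : side) (w : word X1) : word X1 :=
  match w with
  | WGen x => WGen (bd e ord0 x)
  | WBul x y => match e with Src => wbd e y | Tgt => wbd e x end
  end.

Fixpoint wwf (w : word X1) : Prop :=
  match w with
  | WGen _ => True
  | WBul x y => [/\ wwf x, wwf y & wbd Src x = wbd Tgt y]
  end.

Definition cword : Type := {w : word X1 | wwf w}.

Lemma wwf_bd e w : wwf w -> wwf (wbd e w).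
Proof. by elim: w => //= x IHx y IHy [/IHx wx /IHy wy _]; case: {IHx IHy} e wx wy. Qed.

Lemma wbd_idem d e w : wbd d (wbd e w) = wbd e w.
Proof.
elim: w => [x|x IHx y IHy] /=; first by rewrite bd_idem.
by case: e IHx IHy => /=.
Qed.

Definition cword_bd (e : side) (i : 'I_1) (w : cword) : cword :=
  exist _ (wbd e (sval w)) (wwf_bd e (svalP w)).

Lemma cword_idem d e i w : cword_bd d i (cword_bd e i w) = cword_bd e i w.
Proof. by apply: eq_exist; apply: wbd_idem. Qed.

Lemma cword_upper d e (i j : 'I_1) w : i < j ->
  cword_bd d j (cword_bd e i w) = cword_bd e i w.
Proof. by rewrite !ord1. Qed.

Lemma cword_lower d e (i j : 'I_1) w : i < j ->
  cword_bd e i (cword_bd d j w) = cword_bd e i w.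
Proof. by rewrite !ord1. Qed.

Definition cword_gr : grCat 1 := GrCat cword_idem cword_upper cword_lower.

Lemma cword_comp_subproof (x y : cword_gr) : src ord0 x = tgt ord0 y ->
  wwf (WBul (sval x) (sval y)).
Proof. by move=> /(congr1 sval) /= xy; split=> //; apply: svalP. Qed.

Definition cword_comp (i : 'I_1) (x y : cword_gr) : cword_gr :=
  match pselect (src ord0 x = tgt ord0 y) with
  | left xy => exist _ (WBul (sval x) (sval y)) (cword_comp_subproof xy)
  | right _ => x
  end.

Lemma cword_comp_src i (x y : cword_gr) : src i x = tgt i y ->
  src i (cword_comp i x y) = src i y.
Proof.
rewrite !ord1 /cword_comp; case: pselect => // xy _.
exact: eq_exist.
Qed.

Lemma cword_comp_tgt i (x y : cword_gr) : src i x = tgt i y ->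
  tgt i (cword_comp i x y) = tgt i x.
Proof.
rewrite !ord1 /cword_comp; case: pselect => // xy _.
exact: eq_exist.
Qed.

Lemma cword_comp_bd e (i j : 'I_1) (x y : cword_gr) : i < j ->
  src i x = tgt i y ->
  bd e j (cword_comp i x y) = cword_comp i (bd e j x) (bd e j y).
Proof. by rewrite !ord1. Qed.

Definition freePre1 : preCat 1 :=
  PreCat cword_comp_src cword_comp_tgt cword_comp_bd.
End FreePreOne.

Record genData := GenData {
  gd1 : grCat 1;
  gd2 : Type;
  gd_bd : side -> gd2 -> freePre1 gd1;
  gd_glob : forall (e : side) (x : gd2),
    bd e ord0 (gd_bd Src x) = bd e ord0 (gd_bd Tgt x)
}.

Section Generated.
Variable X : genData.

Notation C := (freePre1 (gd1 X)).

Definition gen_sort : Type := (gd2 X + C)%type.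

Definition gen_bd (e : side) (i : 'I_2) (x : gen_sort) : gen_sort :=
  match x with
  | inl y => inr (if i == i0 then bd e ord0 (gd_bd Src y) else gd_bd e y)
  | inr c => inr (if i == i0 then bd e ord0 c else c)
  end.

Lemma gen_idem d e i x : gen_bd d i (gen_bd e i x) = gen_bd e i x.
Proof. by case: (ordI2 i) x => -> [x|x] //; congr inr; apply: (bd_idem (g := C)). Qed.

Lemma gen_upper d e (i j : 'I_2) x : i < j ->
  gen_bd d j (gen_bd e i x) = gen_bd e i x.
Proof. by case: (ordI2 i) (ordI2 j) x => -> [] -> // [x|x]. Qed.

Lemma gen_lower d e (i j : 'I_2) x : i < j ->
  gen_bd e i (gen_bd d j x) = gen_bd e i x.
Proof.
case: (ordI2 i) (ordI2 j) x => -> [] -> // [x|x] // _.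
case: d => //; congr inr; apply: esym; apply: gd_glob.
Qed.

Definition genGr : grCat 2 := GrCat gen_idem gen_upper gen_lower.

Definition inC (c : C) : genGr := inr c.

(* Again the length grading is implicit; the length one words are T_1 = X. *)
Inductive fword := FGen of genGr | FBul of 'I_2 & fword & fword.

Definition fcomp (i : 'I_2) (x y : fword) : fword :=
  match x, y with
  | FGen (inr c), FGen (inr d) =>
      if i == i0 then FGen (inC (comp ord0 c d)) else FBul i x y
  | _, _ => FBul i x y
  end.

Fixpoint fbd (e : side) (i : 'I_2) (w : fword) : fword :=
  match w with
  | FGen x => FGen (bd e i x)
  | FBul j x y =>
      if j < i then fcomp j (fbd e i x) (fbd e i y)
      else match e with Src => fbd e i y | Tgt => fbd e i x end
  end.

Definition isC (w : fword) : bool := if w is FGen (inr _) then true else false.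

Fixpoint fwf (w : fword) : Prop :=
  match w with
  | FGen _ => True
  | FBul i x y => [/\ fwf x, fwf y, fbd Src i x = fbd Tgt i y
                    & ~~ [&& i == i0, isC x & isC y]]
  end.

Lemma fbd_C e i w : exists c : C, fbd e i w = FGen (inC c).
Proof.
elim: w => [[x|x]|j x [c Ec] y [d Ed]] /=; try by eexists.
case: ifP => [ji|_]; last by case: e Ec Ed; [exists d|exists c].
have -> : j = i0 by case: (ordI2 i) (ordI2 j) ji => -> [] ->.
by rewrite Ec Ed /=; eexists.
Qed.

Lemma FGen_inC_inj c d : FGen (inC c) = FGen (inC d) -> c = d.
Proof. by case. Qed.

Lemma fbd_inC0 e c : fbd e i0 (FGen (inC c)) = FGen (inC (bd e ord0 c)).
Proof. by []. Qed.

Lemma fcomp_inC c d :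
  fcomp i0 (FGen (inC c)) (FGen (inC d)) = FGen (inC (comp ord0 c d)).
Proof. by []. Qed.

Lemma fwf_bd e i w : fwf (fbd e i w).
Proof. by have [c ->] := fbd_C e i w. Qed.

Lemma fbd_idem d e i w : fbd d i (fbd e i w) = fbd e i w.
Proof.
elim: w => [x|j x IHx y IHy]; first by rewrite /= gen_idem.
case/orP: (leqVgt i j) => [ij|ji] /=.
  by rewrite ltnNge ij /=; case: e IHx IHy.
rewrite ji; have -> : i = i1 by case: (ordI2 i) (ordI2 j) ji => -> [] ->.
have -> : j = i0 by case: (ordI2 i) (ordI2 j) ji => -> [] ->.
have [c ->] := fbd_C e i1 x; have [c' ->] := fbd_C e i1 y.
by [].
Qed.

Lemma fbd_upper d e (i j : 'I_2) w : i < j -> fbd d j (fbd e i w) = fbd e i w.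
Proof.
move=> ij; have [c ->] := fbd_C e i w.
by case: (ordI2 i) (ordI2 j) ij => -> [] ->.
Qed.

Lemma fbd_lower d e (i j : 'I_2) w : i < j -> fwf w ->
  fbd e i (fbd d j w) = fbd e i w.
Proof.
case: (ordI2 i) (ordI2 j) => -> [] -> // _.
elim: w d e => [x|k x IHx y IHy] d e; first by rewrite /= gen_lower.
case=> /IHx Ex /IHy Ey; case: (ordI2 k) => -> xy _ /=; last first.
  have Exy f : fbd f i0 x = fbd f i0 y by rewrite -(Ex Src) xy Ey.
  by case: d; case: e; rewrite ?Ex ?Ey ?Exy.
have : fbd Src i0 (fbd d i1 x) = fbd Tgt i0 (fbd d i1 y) by rewrite Ex Ey.
have -> : (if e is Src then fbd e i0 y else fbd e i0 x) =
          if e is Src then fbd e i0 (fbd d i1 y) else fbd e i0 (fbd d i1 x).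
  by rewrite Ex Ey.
have [c ->] := fbd_C d i1 x; have [c' ->] := fbd_C d i1 y.
rewrite fcomp_inC !fbd_inC0 => /FGen_inC_inj cc'.
by case: e; rewrite (comp_src, comp_tgt).
Qed.

Definition fcell : Type := {w : fword | fwf w}.

Definition fcell_bd (e : side) (i : 'I_2) (w : fcell) : fcell :=
  exist _ (fbd e i (sval w)) (fwf_bd e i (sval w)).

Lemma fcell_idem d e i w : fcell_bd d i (fcell_bd e i w) = fcell_bd e i w.
Proof. by apply: eq_exist; apply: fbd_idem. Qed.

Lemma fcell_upper d e (i j : 'I_2) w : i < j ->
  fcell_bd d j (fcell_bd e i w) = fcell_bd e i w.
Proof. by move=> ij; apply: eq_exist; apply: fbd_upper. Qed.

Lemma fcell_lower d e (i j : 'I_2) w : i < j ->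
  fcell_bd e i (fcell_bd d j w) = fcell_bd e i w.
Proof. by move=> ij; apply: eq_exist; apply: fbd_lower => //; apply: svalP. Qed.

Definition fcell_gr : grCat 2 := GrCat fcell_idem fcell_upper fcell_lower.

Variant fcomp_spec i x y : fword -> Type :=
  | FcompC c d of i = i0 & x = FGen (inC c) & y = FGen (inC d) :
      fcomp_spec i x y (FGen (inC (comp ord0 c d)))
  | FcompBul of ~~ [&& i == i0, isC x & isC y] : fcomp_spec i x y (FBul i x y).

Lemma fcompP i x y : fcomp_spec i x y (fcomp i x y).
Proof.
case: x y => [[x|c]|j x x'] [[y|d]|k y y'] /=; try by right; rewrite /= ?andbF.
by case: eqP => [i_0|/eqP i_n0]; [left|right; rewrite (negPf i_n0)].
Qed.

Lemma fcell_comp_subproof i (x y : fcell_gr) : src i x = tgt i y ->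
  fwf (fcomp i (sval x) (sval y)).
Proof.
move=> /(congr1 sval) /= xy; case: fcompP => //= nC.
by split=> //; apply: svalP.
Qed.

Definition fcell_comp (i : 'I_2) (x y : fcell_gr) : fcell_gr :=
  match pselect (src i x = tgt i y) with
  | left xy => exist _ (fcomp i (sval x) (sval y)) (fcell_comp_subproof xy)
  | right _ => x
  end.

Lemma fcell_comp_src i (x y : fcell_gr) : src i x = tgt i y ->
  src i (fcell_comp i x y) = src i y.
Proof.
rewrite /fcell_comp; case: pselect => // xy _; apply: eq_exist => /=.
move/(congr1 sval): (xy) => /=.
case: fcompP => [c d -> -> ->|_ _ /=]; last by rewrite ltnn.
by rewrite !fbd_inC0 => /FGen_inC_inj cd; rewrite comp_src.
Qed.

Lemma fcell_comp_tgt i (x y : fcell_gr) : src i x = tgt i y ->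
  tgt i (fcell_comp i x y) = tgt i x.
Proof.
rewrite /fcell_comp; case: pselect => // xy _; apply: eq_exist => /=.
move/(congr1 sval): (xy) => /=.
case: fcompP => [c d -> -> ->|_ _ /=]; last by rewrite ltnn.
by rewrite !fbd_inC0 => /FGen_inC_inj cd; rewrite comp_tgt.
Qed.

Lemma fcell_comp_bd e (i j : 'I_2) (x y : fcell_gr) : i < j ->
  src i x = tgt i y ->
  bd e j (fcell_comp i x y) = fcell_comp i (bd e j x) (bd e j y).
Proof.
move=> ij xy; rewrite /fcell_comp.
case: pselect => // xy1; case: pselect => [xy2|]; last first.
  by rewrite !bd_lower.
apply: eq_exist => /=; move: ij.
case: (ordI2 i) (ordI2 j) => -> [] -> //= _.
by case: fcompP => [c d _ -> ->|].
Qed.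

Definition freePre2 : preCat 2 :=
  PreCat fcell_comp_src fcell_comp_tgt fcell_comp_bd.

Definition gen_incl (x : genGr) : freePre2 := exist _ (FGen x) I.
End Generated.

Definition is_generated (X : genData) (A : bicat) (G0 : freePre2 X -> A) : Prop :=
  is_pre_map G0 /\
  forall (D : bicat) (F : freePre2 X -> D), is_pre_map F ->
    exists! H : A -> D, is_bicat_map H /\ H \o G0 =1 F.

Definition iotaA (X : genData) (A : bicat) (G0 : freePre2 X -> A) : genGr X -> A :=
  G0 \o @gen_incl X.

Definition is_quotient (A : bicat) (R : A -> A -> Prop) (Q : bicat) (G : A -> Q) :
    Prop :=
  [/\ is_bicat_map G,
      forall x y : A, R x y -> G x = G y
    & forall (B : bicat) (F : A -> B), is_bicat_map F ->
        (forall x y : A, R x y -> F x = F y) ->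
        exists! H : Q -> B, is_bicat_map H /\ H \o G =1 F].

(* Main.v *)
From mathcomp Require Import all_boot.
From mathcomp Require Import boolp.
Require Import Defs.

Set Implicit Arguments.
Unset Strict Implicit.
Unset Printing Implicit Defensive.

(** Bicategories, in the sense used here, are the models of a partial algebraic
    theory: the operations [bd], [comp], [alpha], [lambda], [rho] and inversion
    of invertible 2-cells have domains that every map respects, and once inversion
    is an operation the axioms are equations between such expressions.  Initial
    models can therefore be built from syntax.  Fix a set [S] and a class of functions
    from [S] to bicategories (the models).  A formal expression over [S] is
    valid if all its subexpressions are composable in every model, and two
    valid expressions are identified if they are equal in every model.  Since
    composability and the axioms hold in the quotient as soon as they hold in
    every model, the quotient is a bicategory [presented]; evaluation is then a
    map to each model, unique by induction on expressions
    ([presented_universal]), and evaluations are jointly injective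
    ([tcell_ext]).  The quantification over all bicategories occurs only inside
    propositions, so the quotient is as small as [S].

    Taking as models the maps of pre-2-categories out of the free pre-2-category
    of [X] gives the bicategory generated by [X] ([generated_exists]); taking the
    maps of bicategories out of [A] that respect a relation gives the quotient of
    [A] by that relation ([quotient_exists]).

    The universal property with respect to [X] itself follows because a graded
    map on [X] that is multiplicative on 1-cells extends uniquely to the free
    pre-2-category ([extend_pre_map], [freePre2_map_unique]).  Injectivity on
    generators needs a bicategory in which they stay distinct: over any
    pre-1-category, the parallel pairs of 1-cells decorated with an element of
    Z/2 form one ([labelled]).  Its boundaries separate the words of [X], and
    decorating a single generating 2-cell separates it from everything else
    ([iotaA_injective]).

    For presentations, take as generators all 1-cells and all 2-cells of [B],
    and as relation the kernel of the evaluation [G] of the generated bicategory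
    in [B].  [G] has a section sending each cell to the corresponding generating
    2-cell.  The section does not commute with compositions, but it preserves
    composability, because the boundaries of generators are again generators;
    hence any map that respects the kernel descends along it to a map of
    bicategories out of [B] ([tautological_presentation]). *)

(** * Boundaries, 1-cells and inverses *)

(** 0-boundaries factor through 1-boundaries, and [a] and [b] share the middle
    1-cell. *)
Lemma bd0_comp1 (A : preCat 2) e (a b : A) : src i1 a = tgt i1 b ->
  bd e i0 (a **1 b) = bd e i0 a /\ bd e i0 (a **1 b) = bd e i0 b.
Proof.
move=> ab; have lower d (x : A) : bd e i0 (bd d i1 x) = bd e i0 x by apply: bd_lower.
have ->: bd e i0 a = bd e i0 b by rewrite -(lower Src a) ab lower.
by rewrite -(lower Src (a **1 b)) comp_src // lower.
Qed.

Lemma bd_is_mor1 (A : grCat 2) e (x : A) : is_mor i1 x -> bd e i1 x = x.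
Proof. by case=> y ->; rewrite bd_idem. Qed.

Lemma is_mor1_bd (A : grCat 2) (x : A) : src i1 x = x -> is_mor i1 x.
Proof. by exists x. Qed.

Lemma is_mor1_map (A B : grCat 2) (f : A -> B) x :
  is_gr_map f -> is_mor i1 x -> is_mor i1 (f x).
Proof. by move=> fbd [y ->]; exists (f y). Qed.

Definition composable3 (A : grCat 2) (h g f : A) : Prop :=
  [/\ is_mor i1 h, is_mor i1 g, is_mor i1 f,
      src i0 h = tgt i0 g & src i0 g = tgt i0 f].

Lemma bd1_comp0 (A : preCat 2) e (a b : A) : src i0 a = tgt i0 b ->
  bd e i1 (a **0 b) = bd e i1 a **0 bd e i1 b.
Proof. exact: comp_bd. Qed.

Lemma is_mor1_comp0 (A : preCat 2) (g f : A) : is_mor i1 g -> is_mor i1 f ->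
  src i0 g = tgt i0 f -> is_mor i1 (g **0 f).
Proof. by move=> mg mf gf; apply: is_mor1_bd; rewrite bd1_comp0 ?bd_is_mor1. Qed.

Lemma is_mor1_bd1 (A : grCat 2) e (a : A) : is_mor i1 (bd e i1 a).
Proof. by apply: is_mor1_bd; rewrite bd_idem. Qed.

Lemma composable3_bd1 (A : grCat 2) e (c b a : A) :
    src i0 c = tgt i0 b -> src i0 b = tgt i0 a ->
  composable3 (bd e i1 c) (bd e i1 b) (bd e i1 a).
Proof.
move=> cb ba.
by split; rewrite ?bd_lower //; apply: is_mor1_bd1.
Qed.

Lemma interchange_composable (A : preCat 2) (a b c d : A) :
    src i1 a = tgt i1 b -> src i1 c = tgt i1 d -> src i0 a = tgt i0 c ->
  [/\ src i0 (a **1 b) = tgt i0 (c **1 d), src i0 b = tgt i0 d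
    & src i1 (a **0 c) = tgt i1 (b **0 d)].
Proof.
move=> ab cd ac.
have bd_0 : src i0 b = tgt i0 d.
  by rewrite -(bd0_comp1 _ ab).2 (bd0_comp1 _ ab).1 ac -(bd0_comp1 _ cd).2 (bd0_comp1 _ cd).1.
by rewrite !bd1_comp0 // ab cd (bd0_comp1 _ ab).2 (bd0_comp1 _ cd).2.
Qed.

Definition is_inverse (A : preCat 2) (a b : A) : Prop :=
  [/\ src i1 b = tgt i1 a, tgt i1 b = src i1 a,
      b **1 a = src i1 a & a **1 b = tgt i1 a].

(** Uniqueness makes inversion preserved by every map, so that inverses can be added
    to the syntax of expressions without changing the notion of map. *)
Lemma inverse_unique (A : bicat) (a b c : A) :
  is_inverse a b -> is_inverse a c -> b = c.
Proof.
move=> [sb tb ba ab] [sc tc ca ac].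
by rewrite -[b]comp1_src sb -ac -comp1A ?ba // -tc comp1_tgt.
Qed.

Definition inv2 (A : preCat 2) (a : A) : A :=
  if pselect (is_iso2 a) is left iso then sval (cid iso) else a.

Lemma inv2P (A : preCat 2) (a : A) : is_iso2 a -> is_inverse a (inv2 a).
Proof. by rewrite /inv2; case: pselect => // iso _; case: cid. Qed.

Lemma is_inverse_map (A B : preCat 2) (f : A -> B) (a b : A) :
  is_pre_map f -> is_inverse a b -> is_inverse (f a) (f b).
Proof.
by move=> [fbd fc] [sb tb ba ab]; split; rewrite -?fbd -?fc ?sb ?tb ?ba ?ab.
Qed.

(** * Composability in the coherence axioms *)

(** The sides of the coherence axioms are composable as soon as the constraint
    cells have the expected boundaries.  This is isolated from the axioms
    themselves because it is needed for both bicategories constructed below. *)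
Section ConstraintBoundaries.
Variables (A : preCat 2) (al : A -> A -> A -> A) (la rh : A -> A).
Hypothesis al_bd : forall h g f : A, composable3 h g f ->
  [/\ src i1 (al h g f) = (h **0 g) **0 f,
      tgt i1 (al h g f) = h **0 (g **0 f) & is_iso2 (al h g f)].
Hypothesis la_bd : forall f : A, is_mor i1 f ->
  [/\ src i1 (la f) = tgt i0 f **0 f, tgt i1 (la f) = f & is_iso2 (la f)].
Hypothesis rh_bd : forall f : A, is_mor i1 f ->
  [/\ src i1 (rh f) = f **0 src i0 f, tgt i1 (rh f) = f & is_iso2 (rh f)].

Lemma alpha_nat_composable (c b a : A) :
    src i0 c = tgt i0 b -> src i0 b = tgt i0 a ->
  src i1 (al (tgt i1 c) (tgt i1 b) (tgt i1 a)) = tgt i1 ((c **0 b) **0 a) /\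
  src i1 (c **0 (b **0 a)) = tgt i1 (al (src i1 c) (src i1 b) (src i1 a)).
Proof.
move=> cb ba.
have [sT _ _] := al_bd (composable3_bd1 Tgt cb ba).
have [_ tS _] := al_bd (composable3_bd1 Src cb ba).
have cb_a : src i0 (c **0 b) = tgt i0 a by rewrite comp_src.
have c_ba : src i0 c = tgt i0 (b **0 a) by rewrite comp_tgt.
by rewrite sT tS !bd1_comp0.
Qed.

Lemma lambda_nat_composable (a : A) :
  src i1 (la (tgt i1 a)) = tgt i1 (tgt i0 a **0 a) /\
  src i1 a = tgt i1 (la (src i1 a)).
Proof.
have [sT _ _] := la_bd (is_mor1_bd1 Tgt a).
have [_ tS _] := la_bd (is_mor1_bd1 Src a).
by rewrite sT tS bd1_comp0 ?bd_idem // bd_lower // bd_upper.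
Qed.

Lemma rho_nat_composable (a : A) :
  src i1 (rh (tgt i1 a)) = tgt i1 (a **0 src i0 a) /\
  src i1 a = tgt i1 (rh (src i1 a)).
Proof.
have [sT _ _] := rh_bd (is_mor1_bd1 Tgt a).
have [_ tS _] := rh_bd (is_mor1_bd1 Src a).
by rewrite sT tS bd1_comp0 ?bd_idem // bd_lower // bd_upper.
Qed.

Lemma pentagon_composable (k h g f : A) :
    is_mor i1 k -> is_mor i1 h -> is_mor i1 g -> is_mor i1 f ->
    src i0 k = tgt i0 h -> src i0 h = tgt i0 g -> src i0 g = tgt i0 f ->
  [/\ composable3 k h (g **0 f) /\ composable3 (k **0 h) g f,
      composable3 k (h **0 g) f,
      src i0 k = tgt i0 (al h g f) /\ src i0 (al k h g) = tgt i0 f,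
      src i1 (al k h (g **0 f)) = tgt i1 (al (k **0 h) g f)
    & src i1 (al k (h **0 g) f) = tgt i1 (al k h g **0 f) /\
      src i1 (k **0 al h g f) =
        tgt i1 (al k (h **0 g) f **1 (al k h g **0 f))].
Proof.
move=> mk mh mg mf kh hg gf.
have mgf := is_mor1_comp0 mg mf gf; have mkh := is_mor1_comp0 mk mh kh.
have mhg := is_mor1_comp0 mh mg hg.
have h_gf : src i0 h = tgt i0 (g **0 f) by rewrite comp_tgt.
have kh_g : src i0 (k **0 h) = tgt i0 g by rewrite comp_src.
have k_hg : src i0 k = tgt i0 (h **0 g) by rewrite comp_tgt.
have hg_f : src i0 (h **0 g) = tgt i0 f by rewrite comp_src.
have [s1 _ _] := al_bd (And5 mk mh mgf kh h_gf).
have [_ t2 _] := al_bd (And5 mkh mg mf kh_g gf).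
have [s3 _ _] := al_bd (And5 mh mg mf hg gf).
have [s4 t4 _] := al_bd (And5 mk mhg mf k_hg hg_f).
have [s5 t5 _] := al_bd (And5 mk mh mg kh hg).
have k3 : src i0 k = tgt i0 (al h g f).
  by rewrite -(bd_lower Src Tgt (i := i0) (j := i1)) // s3 !comp_tgt.
have s5f : src i0 (al k h g) = tgt i0 f.
  by rewrite -(bd_lower Src Src (i := i0) (j := i1)) // s5 !comp_src.
have c45 : src i1 (al k (h **0 g) f) = tgt i1 (al k h g **0 f).
  by rewrite s4 bd1_comp0 // t5 bd_is_mor1.
have c345 : src i1 (k **0 al h g f) =
    tgt i1 (al k (h **0 g) f **1 (al k h g **0 f)).
  by rewrite comp_tgt // t4 bd1_comp0 // s3 bd_is_mor1.
by split=> //; rewrite s1 t2.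
Qed.

Lemma triangle_composable (g f : A) :
    is_mor i1 g -> is_mor i1 f -> src i0 g = tgt i0 f ->
  [/\ composable3 g (src i0 g) f, src i0 g = tgt i0 (la f),
      src i0 (rh g) = tgt i0 f
    & src i1 (g **0 la f) = tgt i1 (al g (src i0 g) f)].
Proof.
move=> mg mf gf.
have gugf : composable3 g (src i0 g) f.
  by split; rewrite ?bd_idem //; apply: is_mor1_bd; rewrite bd_upper.
have [_ tA _] := al_bd gugf.
have [sL tL _] := la_bd mf; have [sR tR _] := rh_bd mg.
have gL : src i0 g = tgt i0 (la f).
  by rewrite gf -(bd_lower Tgt Tgt (i := i0) (j := i1) (la f)) // tL.
split=> //; first by rewrite -gf -(bd_lower Tgt Src (i := i0) (j := i1) (rh g)) // tR.
by rewrite tA bd1_comp0 // sL bd_is_mor1 // gf.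
Qed.
End ConstraintBoundaries.

(** * The bicategory presented by a class of models *)

Section Presented.
Variables (S : Type) (model : forall D : bicat, (S -> D) -> Prop).

Inductive term :=
  | Gen of S
  | Bd of side & 'I_2 & term
  | Comp of 'I_2 & term & term
  | Alpha of term & term & term
  | Lambda of term
  | Rho of term
  | Inv of term.

(** Evaluation is total, with arbitrary values on expressions that are not
    [defined]; composability of subexpressions is recorded separately. *)
Fixpoint eval (D : bicat) (F : S -> D) (t : term) : D :=
  match t with
  | Gen x => F x
  | Bd e i t => bd e i (eval F t)
  | Comp i t u => comp i (eval F t) (eval F u)
  | Alpha h g f => alpha (eval F h) (eval F g) (eval F f)
  | Lambda f => lambda (eval F f)
  | Rho f => rho (eval F f)
  | Inv a => inv2 (eval F a)
  end.

Fixpoint defined (D : bicat) (F : S -> D) (t : term) : Prop :=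
  match t with
  | Gen _ => True
  | Bd _ _ t => defined F t
  | Comp i t u =>
      [/\ defined F t, defined F u & src i (eval F t) = tgt i (eval F u)]
  | Alpha h g f => [/\ defined F h, defined F g, defined F f
                     & composable3 (eval F h) (eval F g) (eval F f)]
  | Lambda f | Rho f => defined F f /\ is_mor i1 (eval F f)
  | Inv a => defined F a /\ is_iso2 (eval F a)
  end.

Definition valid (t : term) : Prop :=
  forall (D : bicat) (F : S -> D), model F -> defined F t.

Definition teq (t u : term) : Prop :=
  forall (D : bicat) (F : S -> D), model F -> eval F t = eval F u.

(** A representative of the class of [t].  The predicate handed to the choice
    operator depends only on the class, so equivalent valid expressions have
    the same representative. *)
Definition canon t : term :=
  if pselect (exists u, valid u /\ teq t u) is left ex then sval (cid ex) else t.

Lemma canonP t : valid t -> valid (canon t) /\ teq t (canon t).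
Proof.
rewrite /canon; case: pselect => [ex _|nex vt]; first by case: cid.
by case: nex; exists t.
Qed.

Lemma canon_teq t u : valid t -> teq t u -> canon t = canon u.
Proof.
move=> vt tu; rewrite /canon.
have -> : (fun v => valid v /\ teq u v) = (fun v => valid v /\ teq t v).
  apply/funext => v; apply/propext; split=> -[vv uv]; split=> // D F KF.
    by rewrite tu // uv.
  by rewrite -tu // uv.
by case: pselect => // -[]; exists t.
Qed.

Lemma canon_idem t : valid t -> canon (canon t) = canon t.
Proof. by move=> vt; apply/esym/canon_teq => //; apply: (canonP vt).2. Qed.

Definition tcell : Type := {t : term | valid t /\ canon t = t}.

Definition cls t (vt : valid t) : tcell :=
  exist _ (canon t) (conj (canonP vt).1 (canon_idem vt)).

(** Expressions formed from non-composable cells need not be valid, and the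
    operations of a bicategory are total: [a] serves as the junk value. *)
Definition cls_or (a : tcell) (t : term) : tcell :=
  if pselect (valid t) is left vt then cls vt else a.

Definition ev (D : bicat) (F : S -> D) (a : tcell) : D := eval F (sval a).

Lemma ev_cls (D : bicat) (F : S -> D) t (vt : valid t) :
  model F -> ev F (cls vt) = eval F t.
Proof. by move=> KF; rewrite /ev /= -(canonP vt).2. Qed.

Lemma ev_cls_or (D : bicat) (F : S -> D) a t :
  valid t -> model F -> ev F (cls_or a t) = eval F t.
Proof. by rewrite /cls_or; case: pselect => // vt _; apply: ev_cls. Qed.

Lemma ev_defined (D : bicat) (F : S -> D) (a : tcell) : model F -> defined F (sval a).
Proof. by case: a => t [vt _] /=; apply: vt. Qed.

(** Joint injectivity of evaluations: every equation in the quotient, be it an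
    axiom or a composability condition, is checked in the models. *)
Lemma tcell_ext (a b : tcell) :
  (forall (D : bicat) (F : S -> D), model F -> ev F a = ev F b) -> a = b.
Proof.
case: a b => [t [vt ct]] [u [vu cu]] tu; apply: eq_exist.
by rewrite -ct -cu; apply: canon_teq.
Qed.

Definition tcell_bd e (i : 'I_2) (a : tcell) : tcell := cls_or a (Bd e i (sval a)).

Lemma ev_bd_subproof (D : bicat) (F : S -> D) e i a :
  model F -> ev F (tcell_bd e i a) = bd e i (ev F a).
Proof. by apply: ev_cls_or => D' F' KF /=; apply: ev_defined. Qed.

Lemma tcell_idem d e i a : tcell_bd d i (tcell_bd e i a) = tcell_bd e i a.
Proof. by apply: tcell_ext => D F KF; rewrite !ev_bd_subproof // bd_idem. Qed.

Lemma tcell_upper d e (i j : 'I_2) a : i < j ->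
  tcell_bd d j (tcell_bd e i a) = tcell_bd e i a.
Proof. by move=> ij; apply: tcell_ext => D F KF; rewrite !ev_bd_subproof // bd_upper. Qed.

Lemma tcell_lower d e (i j : 'I_2) a : i < j ->
  tcell_bd e i (tcell_bd d j a) = tcell_bd e i a.
Proof. by move=> ij; apply: tcell_ext => D F KF; rewrite !ev_bd_subproof // bd_lower. Qed.

Definition tcell_gr : grCat 2 := GrCat tcell_idem tcell_upper tcell_lower.

Lemma ev_gr (D : bicat) (F : S -> D) : model F -> @is_gr_map 2 tcell_gr D (ev F).
Proof. by move=> KF e i a; apply: ev_bd_subproof. Qed.

Definition tcell_comp i (a b : tcell_gr) : tcell_gr := cls_or a (Comp i (sval a) (sval b)).

Lemma ev_comp_subproof (D : bicat) (F : S -> D) i (a b : tcell_gr) :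
  src i a = tgt i b -> model F ->
  ev F (tcell_comp i a b) = comp i (ev F a) (ev F b).
Proof.
move=> ab; apply: ev_cls_or => D' F' KF /=; split; try exact: ev_defined.
by have := congr1 (ev F') ab; rewrite !ev_gr.
Qed.

Lemma tcell_comp_src i (a b : tcell_gr) : src i a = tgt i b ->
  src i (tcell_comp i a b) = src i b.
Proof.
move=> ab; apply: tcell_ext => D F KF; rewrite !ev_gr // ev_comp_subproof //.
by rewrite comp_src // -!ev_gr // ab.
Qed.

Lemma tcell_comp_tgt i (a b : tcell_gr) : src i a = tgt i b ->
  tgt i (tcell_comp i a b) = tgt i a.
Proof.
move=> ab; apply: tcell_ext => D F KF; rewrite !ev_gr // ev_comp_subproof //.
by rewrite comp_tgt // -!ev_gr // ab.
Qed.

Lemma tcell_comp_bd e (i j : 'I_2) (a b : tcell_gr) : i < j ->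
  src i a = tgt i b ->
  bd e j (tcell_comp i a b) = tcell_comp i (bd e j a) (bd e j b).
Proof.
move=> ij ab; apply: tcell_ext => D F KF; rewrite ev_gr // !ev_comp_subproof //.
  by rewrite comp_bd ?ev_gr // -!ev_gr // ab.
by rewrite !bd_lower.
Qed.

Definition tcell_pre : preCat 2 :=
  PreCat tcell_comp_src tcell_comp_tgt tcell_comp_bd.

Lemma ev_pre (D : bicat) (F : S -> D) : model F -> @is_pre_map 2 tcell_pre D (ev F).
Proof. by move=> KF; split=> [|i a b ab]; [apply: ev_gr|apply: ev_comp_subproof]. Qed.

Lemma ev_comp (D : bicat) (F : S -> D) i (a b : tcell_pre) : model F ->
  src i a = tgt i b -> ev F (comp i a b) = comp i (ev F a) (ev F b).
Proof. by move=> KF; apply: (ev_pre KF).2. Qed.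

Definition tcell_alpha (h g f : tcell_pre) : tcell_pre :=
  cls_or h (Alpha (sval h) (sval g) (sval f)).
Definition tcell_lambda (f : tcell_pre) : tcell_pre := cls_or f (Lambda (sval f)).
Definition tcell_rho (f : tcell_pre) : tcell_pre := cls_or f (Rho (sval f)).
Definition tcell_inv (a : tcell_pre) : tcell_pre := cls_or a (Inv (sval a)).

Lemma ev_composable3 (D : bicat) (F : S -> D) (h g f : tcell_pre) : model F ->
  composable3 h g f -> composable3 (ev F h) (ev F g) (ev F f).
Proof.
move=> KF [mh mg mf hg gf]; have evF := ev_gr KF.
by split; try exact: is_mor1_map; rewrite -!evF ?hg ?gf.
Qed.

Lemma ev_alpha (D : bicat) (F : S -> D) (h g f : tcell_pre) : model F ->
  composable3 h g f -> ev F (tcell_alpha h g f) = alpha (ev F h) (ev F g) (ev F f).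
Proof.
move=> KF hgf; apply: ev_cls_or KF => D' F' KF /=.
by split; try exact: ev_defined; apply: ev_composable3.
Qed.

Lemma ev_lambda (D : bicat) (F : S -> D) (f : tcell_pre) : model F ->
  is_mor i1 f -> ev F (tcell_lambda f) = lambda (ev F f).
Proof.
move=> KF mf; apply: ev_cls_or KF => D' F' KF /=.
by split; [apply: ev_defined|apply: is_mor1_map (ev_gr KF) mf].
Qed.

Lemma ev_rho (D : bicat) (F : S -> D) (f : tcell_pre) : model F ->
  is_mor i1 f -> ev F (tcell_rho f) = rho (ev F f).
Proof.
move=> KF mf; apply: ev_cls_or KF => D' F' KF /=.
by split; [apply: ev_defined|apply: is_mor1_map (ev_gr KF) mf].
Qed.

(** The one axiom that asserts an existence; it is why inversion belongs to the
    syntax. *)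
Lemma tcell_iso (a : tcell_pre) :
  (forall (D : bicat) (F : S -> D), model F -> is_iso2 (ev F a)) -> is_iso2 a.
Proof.
move=> iso; exists (tcell_inv a).
have evI D F : @model D F -> ev F (tcell_inv a) = inv2 (ev F a).
  by apply: ev_cls_or => D' F' KF /=; split; [apply: ev_defined|apply: iso].
have sI : src i1 (tcell_inv a) = tgt i1 a.
  by apply: tcell_ext => D F KF; rewrite !ev_gr // evI //; case: (inv2P (iso _ _ KF)).
have tI : tgt i1 (tcell_inv a) = src i1 a.
  by apply: tcell_ext => D F KF; rewrite !ev_gr // evI //; case: (inv2P (iso _ _ KF)).
split=> //; apply: tcell_ext => D F KF; rewrite ev_gr // ev_comp // evI //.
  by case: (inv2P (iso _ _ KF)).
by case: (inv2P (iso _ _ KF)).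
Qed.

Lemma tcell_alpha_bd (h g f : tcell_pre) :
    is_mor i1 h -> is_mor i1 g -> is_mor i1 f ->
    src i0 h = tgt i0 g -> src i0 g = tgt i0 f ->
  [/\ src i1 (tcell_alpha h g f) = (h **0 g) **0 f,
      tgt i1 (tcell_alpha h g f) = h **0 (g **0 f)
    & is_iso2 (tcell_alpha h g f)].
Proof.
move=> mh mg mf hg gf; have hgf : composable3 h g f by [].
have A D F (KF : @model D F) := let: And5 a b c d e := ev_composable3 KF hgf in
  alpha_bd a b c d e.
split; [apply: tcell_ext..|apply: tcell_iso] => D F KF; have [sA tA iA] := A D F KF.
- by rewrite ev_gr // ev_alpha // !ev_comp // comp_src.
- by rewrite ev_gr // ev_alpha // !ev_comp // comp_tgt.
- by rewrite ev_alpha.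
Qed.

Lemma tcell_lambda_bd (f : tcell_pre) : is_mor i1 f ->
  [/\ src i1 (tcell_lambda f) = tgt i0 f **0 f,
      tgt i1 (tcell_lambda f) = f
    & is_iso2 (tcell_lambda f)].
Proof.
move=> mf.
have A D F (KF : @model D F) := lambda_bd (is_mor1_map (ev_gr KF) mf).
split; [apply: tcell_ext..|apply: tcell_iso] => D F KF; have [sA tA iA] := A D F KF.
- by rewrite ev_gr // ev_lambda // !ev_comp ?ev_gr ?bd_idem.
- by rewrite ev_gr // ev_lambda.
- by rewrite ev_lambda.
Qed.

Lemma tcell_rho_bd (f : tcell_pre) : is_mor i1 f ->
  [/\ src i1 (tcell_rho f) = f **0 src i0 f,
      tgt i1 (tcell_rho f) = f
    & is_iso2 (tcell_rho f)].
Proof.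
move=> mf.
have A D F (KF : @model D F) := rho_bd (is_mor1_map (ev_gr KF) mf).
split; [apply: tcell_ext..|apply: tcell_iso] => D F KF; have [sA tA iA] := A D F KF.
- by rewrite ev_gr // ev_rho // !ev_comp ?ev_gr ?bd_idem.
- by rewrite ev_gr // ev_rho.
- by rewrite ev_rho.
Qed.

Lemma tcell_comp1A (a b c : tcell_pre) :
    src i1 a = tgt i1 b -> src i1 b = tgt i1 c ->
  (a **1 b) **1 c = a **1 (b **1 c).
Proof.
move=> ab bc; apply: tcell_ext => D F KF.
by rewrite !ev_comp ?comp_src ?comp_tgt // comp1A // -!(ev_gr KF) ?ab ?bc.
Qed.

Lemma tcell_comp1_src (a : tcell_pre) : a **1 src i1 a = a.
Proof.
by apply: tcell_ext => D F KF; rewrite ev_comp ?bd_idem // ev_gr // comp1_src.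
Qed.

Lemma tcell_comp1_tgt (a : tcell_pre) : tgt i1 a **1 a = a.
Proof.
by apply: tcell_ext => D F KF; rewrite ev_comp ?bd_idem // ev_gr // comp1_tgt.
Qed.

Lemma tcell_interchange (a b c d : tcell_pre) :
    src i1 a = tgt i1 b -> src i1 c = tgt i1 d -> src i0 a = tgt i0 c ->
  (a **1 b) **0 (c **1 d) = (a **0 c) **1 (b **0 d).
Proof.
move=> ab cd ac.
have [c0 bd0 c1] := interchange_composable ab cd ac.
apply: tcell_ext => D F KF; have evF := ev_gr KF.
by rewrite !ev_comp // interchange // -!evF ?ab ?cd ?ac.
Qed.

Lemma tcell_alpha_bd3 (h g f : tcell_pre) : composable3 h g f ->
  [/\ src i1 (tcell_alpha h g f) = (h **0 g) **0 f,
      tgt i1 (tcell_alpha h g f) = h **0 (g **0 f)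
    & is_iso2 (tcell_alpha h g f)].
Proof. by case; apply: tcell_alpha_bd. Qed.

Lemma tcell_alpha_nat (c b a : tcell_pre) :
    src i0 c = tgt i0 b -> src i0 b = tgt i0 a ->
  tcell_alpha (tgt i1 c) (tgt i1 b) (tgt i1 a) **1 ((c **0 b) **0 a) =
  (c **0 (b **0 a)) **1 tcell_alpha (src i1 c) (src i1 b) (src i1 a).
Proof.
move=> cb ba.
have [cT cS] := alpha_nat_composable tcell_alpha_bd3 cb ba.
have cb_a : src i0 (c **0 b) = tgt i0 a by rewrite comp_src.
have c_ba : src i0 c = tgt i0 (b **0 a) by rewrite comp_tgt.
apply: tcell_ext => D F KF; have evF := ev_gr KF.
rewrite !ev_comp // !ev_alpha ?evF ?alpha_nat //; try exact: composable3_bd1.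
  by rewrite -!evF cb.
by rewrite -!evF ba.
Qed.

Lemma tcell_lambda_nat (a : tcell_pre) :
  tcell_lambda (tgt i1 a) **1 (tgt i0 a **0 a) = a **1 tcell_lambda (src i1 a).
Proof.
have [cT cS] := lambda_nat_composable tcell_lambda_bd a.
apply: tcell_ext => D F KF; have evF := ev_gr KF.
by rewrite !ev_comp ?bd_idem // !ev_lambda ?evF ?lambda_nat //; apply: is_mor1_bd1.
Qed.

Lemma tcell_rho_nat (a : tcell_pre) :
  tcell_rho (tgt i1 a) **1 (a **0 src i0 a) = a **1 tcell_rho (src i1 a).
Proof.
have [cT cS] := rho_nat_composable tcell_rho_bd a.
apply: tcell_ext => D F KF; have evF := ev_gr KF.
by rewrite !ev_comp ?bd_idem // !ev_rho ?evF ?rho_nat //; apply: is_mor1_bd1.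
Qed.

Lemma tcell_pentagon (k h g f : tcell_pre) :
    is_mor i1 k -> is_mor i1 h -> is_mor i1 g -> is_mor i1 f ->
    src i0 k = tgt i0 h -> src i0 h = tgt i0 g -> src i0 g = tgt i0 f ->
  tcell_alpha k h (g **0 f) **1 tcell_alpha (k **0 h) g f =
  (k **0 tcell_alpha h g f) **1
    (tcell_alpha k (h **0 g) f **1 (tcell_alpha k h g **0 f)).
Proof.
move=> mk mh mg mf kh hg gf.
have [[c1 c2] c4 [k3 s5f] c12 [c45 c345]] :=
  pentagon_composable tcell_alpha_bd3 mk mh mg mf kh hg gf.
apply: tcell_ext => D F KF; have evF := ev_gr KF.
rewrite !ev_comp // !ev_alpha // !ev_comp // pentagon -?evF ?kh ?hg ?gf //;
  exact: is_mor1_map.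
Qed.

Lemma tcell_triangle (g f : tcell_pre) :
    is_mor i1 g -> is_mor i1 f -> src i0 g = tgt i0 f ->
  (g **0 tcell_lambda f) **1 tcell_alpha g (src i0 g) f = tcell_rho g **0 f.
Proof.
move=> mg mf gf.
have [c3 gL Rf LA] :=
  triangle_composable tcell_alpha_bd3 tcell_lambda_bd tcell_rho_bd mg mf gf.
apply: tcell_ext => D F KF; have evF := ev_gr KF.
rewrite !ev_comp // ev_alpha // ev_lambda // ev_rho // evF triangle //.
- exact: is_mor1_map.
- exact: is_mor1_map.
- by rewrite -!evF gf.
Qed.

Definition presented : bicat :=
  Bicat tcell_alpha_bd tcell_lambda_bd tcell_rho_bd tcell_comp1A
    tcell_comp1_src tcell_comp1_tgt tcell_interchange tcell_alpha_nat
    tcell_lambda_nat tcell_rho_nat tcell_pentagon tcell_triangle.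

Lemma valid_Gen x : valid (Gen x).
Proof. by []. Qed.

Definition presented_gen (x : S) : presented := cls (valid_Gen x).

Lemma ev_bicat (D : bicat) (F : S -> D) :
  model F -> @is_bicat_map presented D (ev F).
Proof.
move=> KF; split; first exact: ev_pre.
- by move=> h g f mh mg mf hg gf; apply: ev_alpha.
- by move=> f; apply: ev_lambda.
- by move=> f; apply: ev_rho.
Qed.

Lemma ev_gen (D : bicat) (F : S -> D) : model F -> ev F \o presented_gen =1 F.
Proof. by move=> KF x; apply: ev_cls. Qed.

Lemma cls_or_sval a b : cls_or a (sval b) = b.
Proof.
case: b => t [vt ct]; rewrite /cls_or; case: pselect => // vt'.
exact: eq_exist.
Qed.

(** The next lemmas say that a valid expression is the result, in [presented], of
    its outermost operation applied to the classes of its subexpressions, whose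
    composability holds in [presented] because it holds in every model. *)
Lemma cls_or_bd a e i t : valid t -> cls_or a (Bd e i t) = bd e i (cls_or a t : presented).
Proof.
move=> vt; apply: tcell_ext => D F KF; rewrite ev_gr // !ev_cls_or //.
Qed.

Lemma cls_or_comp a i t u : valid (Comp i t u) ->
  [/\ valid t, valid u, src i (cls_or a t : presented) = tgt i (cls_or a u : presented)
    & cls_or a (Comp i t u) = comp i (cls_or a t : presented) (cls_or a u)].
Proof.
move=> v; have vt : valid t by move=> D F /v[].
have vu : valid u by move=> D F /v[].
have tu : src i (cls_or a t : presented) = tgt i (cls_or a u : presented).
  by apply: tcell_ext => D F KF; rewrite !ev_gr // !ev_cls_or //; case: (v D F KF).
by split=> //; apply: tcell_ext => D F KF; rewrite (ev_comp KF tu) !ev_cls_or.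
Qed.

Lemma cls_or_is_mor1 a f : valid f ->
  (forall (D : bicat) (F : S -> D), model F -> is_mor i1 (eval F f)) ->
  is_mor i1 (cls_or a f : presented).
Proof.
move=> vf mf; apply: is_mor1_bd; apply: tcell_ext => D F KF.
by rewrite ev_gr // ev_cls_or // bd_is_mor1 //; apply: mf.
Qed.

Lemma cls_or_alpha a h g f : valid (Alpha h g f) ->
  [/\ valid h, valid g, valid f, composable3 (cls_or a h : presented) (cls_or a g) (cls_or a f)
    & cls_or a (Alpha h g f) = alpha (cls_or a h : presented) (cls_or a g) (cls_or a f)].
Proof.
move=> v; have vh : valid h by move=> D F /v[].
have vg : valid g by move=> D F /v[].
have vf : valid f by move=> D F /v[].
have c3 : composable3 (cls_or a h : presented) (cls_or a g) (cls_or a f).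
  split; try by apply: cls_or_is_mor1 => // D F /v[_ _ _ []].
    by apply: tcell_ext => D F KF; rewrite !ev_gr // !ev_cls_or //; case: (v D F KF) => _ _ _ [].
  by apply: tcell_ext => D F KF; rewrite !ev_gr // !ev_cls_or //; case: (v D F KF) => _ _ _ [].
by split=> //; apply: tcell_ext => D F KF; rewrite (ev_alpha KF c3) !ev_cls_or.
Qed.

Lemma cls_or_lambda a f : valid (Lambda f) ->
  [/\ valid f, is_mor i1 (cls_or a f : presented)
    & cls_or a (Lambda f) = lambda (cls_or a f : presented)].
Proof.
move=> v; have vf : valid f by move=> D F /v[].
have mf : is_mor i1 (cls_or a f : presented) by apply: cls_or_is_mor1 => // D F /v[].
by split=> //; apply: tcell_ext => D F KF; rewrite (ev_lambda KF mf) !ev_cls_or.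
Qed.

Lemma cls_or_rho a f : valid (Rho f) ->
  [/\ valid f, is_mor i1 (cls_or a f : presented)
    & cls_or a (Rho f) = rho (cls_or a f : presented)].
Proof.
move=> v; have vf : valid f by move=> D F /v[].
have mf : is_mor i1 (cls_or a f : presented) by apply: cls_or_is_mor1 => // D F /v[].
by split=> //; apply: tcell_ext => D F KF; rewrite (ev_rho KF mf) !ev_cls_or.
Qed.

Lemma cls_or_inv a t : valid (Inv t) ->
  valid t /\ is_inverse (cls_or a t : presented) (cls_or a (Inv t)).
Proof.
move=> v; have vt : valid t by move=> D F /v[].
have iso D F : @model D F -> is_inverse (eval F t) (inv2 (eval F t)).
  by move=> /v[_]; apply: inv2P.
have st : src i1 (cls_or a (Inv t) : presented) = tgt i1 (cls_or a t : presented).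
  by apply: tcell_ext => D F KF; rewrite !ev_gr // !ev_cls_or //; case: (iso D F KF).
have ts : tgt i1 (cls_or a (Inv t) : presented) = src i1 (cls_or a t : presented).
  by apply: tcell_ext => D F KF; rewrite !ev_gr // !ev_cls_or //; case: (iso D F KF).
by split=> //; split=> //; apply: tcell_ext => D F KF;
  rewrite ev_gr // ev_comp // !ev_cls_or //; case: (iso D F KF).
Qed.

(** Every cell is the class of an expression, and a map of bicategories is
    determined on it by induction; inverses are handled by their uniqueness. *)
Lemma ev_unique (D : bicat) (F : S -> D) (H : presented -> D) : model F ->
  is_bicat_map H -> H \o presented_gen =1 F -> H =1 ev F.
Proof.
move=> KF [Hpre Halpha Hlambda Hrho] HF a; have [Hbd Hcomp] := Hpre.
rewrite -{1}[a](cls_or_sval a) /ev.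
have : valid (sval a) by case: a => t [].
elim: (sval a) => [x|e i t IHt|i t IHt u IHu|h IHh g IHg f IHf|f IHf|f IHf|t IHt] vt /=.
- rewrite -HF /=; congr H; apply: tcell_ext => D' F' KF'.
  by rewrite ev_cls_or // ev_cls.
- by rewrite cls_or_bd // Hbd IHt.
- by have [vt1 vu tu ->] := cls_or_comp a vt; rewrite Hcomp // IHt // IHu.
- have [vh vg vf [mh mg mf hg gf] ->] := cls_or_alpha a vt.
  by rewrite Halpha // IHh // IHg // IHf.
- by have [vf mf ->] := cls_or_lambda a vt; rewrite Hlambda // IHf.
- by have [vf mf ->] := cls_or_rho a vt; rewrite Hrho // IHf.
- have [vt' I] := cls_or_inv a vt; apply: inverse_unique (is_inverse_map Hpre I) _.
  by rewrite IHt //; apply: inv2P; case: (vt D F KF).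
Qed.

Lemma presented_universal (D : bicat) (F : S -> D) : model F ->
  exists! H : presented -> D, is_bicat_map H /\ H \o presented_gen =1 F.
Proof.
move=> KF; exists (ev F); split; first by split; [apply: ev_bicat|apply: ev_gen].
by move=> H [mapH HF]; apply/funext => a; rewrite (ev_unique KF mapH HF).
Qed.

End Presented.

Theorem generated_exists (X : genData) :
  exists (A : bicat) (G0 : freePre2 X -> A), is_generated G0.
Proof.
pose K (D : bicat) (F : freePre2 X -> D) := is_pre_map F.
exists (presented K), (@presented_gen _ K); split; last by move=> D F; apply: presented_universal.
have gbd : is_gr_map (@presented_gen _ K).
  move=> e i x; apply: tcell_ext => D F KF; rewrite ev_gr // !ev_cls //=; exact: KF.1.
split=> // i a b ab; apply: tcell_ext => D F KF.
by rewrite ev_comp -?gbd ?ab // !ev_cls //=; apply: KF.2.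
Qed.

(** Being a map of bicategories is an equational property of [G], and it holds
    after evaluation in each model because the models are such maps. *)
Theorem quotient_exists (A : bicat) (R : A -> A -> Prop) :
  exists (Q : bicat) (G : A -> Q), is_quotient R G.
Proof.
pose K (D : bicat) (F : A -> D) := is_bicat_map F /\ forall x y, R x y -> F x = F y.
exists (presented K), (@presented_gen _ K); split; last first.
- by move=> D F mapF RF; apply: presented_universal.
- by move=> x y xy; apply: tcell_ext => D F KF; rewrite !ev_cls //=; apply: KF.2.
have gbd : is_gr_map (@presented_gen _ K).
  by move=> e i x; apply: tcell_ext => D F KF; rewrite ev_gr // !ev_cls //=; case: KF => -[[KF]].
split.
- split=> // i a b ab; apply: tcell_ext => D F KF.
  by rewrite ev_comp -?gbd ?ab // !ev_cls //=; case: KF => -[[_ KF]] *; apply: KF.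
- move=> h g f mh mg mf hg gf; apply: tcell_ext => D F KF.
  rewrite ev_alpha //; last by split; rewrite -?gbd ?hg ?gf //; exact: is_mor1_map.
  by rewrite !ev_cls //=; case: KF => -[_ KF _ _ _]; apply: KF.
- move=> f mf; apply: tcell_ext => D F KF.
  rewrite ev_lambda //; last by exact: is_mor1_map.
  by rewrite !ev_cls //=; case: KF => -[_ _ KF _ _]; apply: KF.
- move=> f mf; apply: tcell_ext => D F KF.
  rewrite ev_rho //; last by exact: is_mor1_map.
  by rewrite !ev_cls //=; case: KF => -[_ _ _ KF _]; apply: KF.
Qed.

(** * Maps out of the free pre-2-category *)

Section FreePre2.
Variables (X : genData) (B : bicat) (phi : genGr X -> B).

Fixpoint feval (w : fword X) : B :=
  match w with
  | FGen x => phi x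
  | FBul i x y => comp i (feval x) (feval y)
  end.

Definition extend (w : freePre2 X) : B := feval (sval w).

Hypothesis phi_bd : is_gr_map phi.
Hypothesis phi_comp : @is_pre_map 2 (pre12 (freePre1 (gd1 X))) B (phi \o @inC X).

(** The only composites that [fcomp] reduces are those of two words of 1-cells,
    on which [phi] is multiplicative. *)
Lemma feval_fcomp i (x y : fword X) : fbd Src i x = fbd Tgt i y ->
  feval (fcomp i x y) = comp i (feval x) (feval y).
Proof.
case: fcompP => // c d -> -> -> /FGen_inC_inj cd.
by apply: (phi_comp.2 i0 c d); rewrite /= /pre12_bd cd.
Qed.

Lemma feval_bd e i (w : fword X) : fwf w -> feval (fbd e i w) = bd e i (feval w).
Proof.
elim: w e i => [x|j x IHx y IHy] e i /=; first by rewrite phi_bd.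
case=> wx wy xy _.
have Exy : src j (feval x) = tgt j (feval y) by rewrite -IHx // xy IHy.
case: (ordI2 i) (ordI2 j) xy Exy => -> [] -> /= xy Exy.
- by case: e; rewrite ?comp_src ?comp_tgt // ?IHx ?IHy.
- by case: e; rewrite ?(bd0_comp1 Src Exy).2 ?(bd0_comp1 Tgt Exy).1 ?IHx ?IHy.
- by rewrite bd1_comp0 // feval_fcomp ?IHx ?IHy // !fbd_lower.
- by case: e; rewrite ?comp_src ?comp_tgt // ?IHx ?IHy.
Qed.

Lemma extend_pre_map : is_pre_map extend.
Proof.
split=> [e i [w fw]|i x y xy]; first exact: feval_bd.
rewrite /extend /= /fcell_comp; case: pselect => // xy' /=.
by apply: feval_fcomp; move/(congr1 sval): xy.
Qed.
End FreePre2.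

Lemma freePre2_map_unique (X : genData) (B : preCat 2) (F G : freePre2 X -> B) :
  is_pre_map F -> is_pre_map G -> F \o @gen_incl X =1 G \o @gen_incl X -> F =1 G.
Proof.
move=> [Fbd Fc] [Gbd Gc] FG [w].
elim: w => [x|i x IHx y IHy] fw.
  have -> : exist _ (FGen x) fw = gen_incl x by apply: eq_exist.
  exact: FG.
have [wx wy xy nC] := fw.
pose x' : freePre2 X := exist _ x wx; pose y' : freePre2 X := exist _ y wy.
have xy' : src i x' = tgt i y' by apply: eq_exist.
suff -> : exist _ (FBul i x y) fw = comp i x' y' by rewrite Fc // Gc // IHx IHy.
rewrite /= /fcell_comp; case: pselect => // xy''; apply: eq_exist => /=.
(* A well-formed bullet is never a reducible composite. *)
case: fcompP nC => // c d -> -> ->; by rewrite eqxx.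
Qed.

Lemma gen_incl_gr (X : genData) : @is_gr_map 2 (genGr X) (freePre2 X) (@gen_incl X).
Proof. by move=> e i x; apply: eq_exist. Qed.

(** * Separating the generators *)

Section Labelled.
Variable M : preCat 1.

Notation bnd e := (bd e (@ord0 0)).

Definition parallel (f g : M) : Prop := forall e, bnd e f = bnd e g.

(** A 2-cell is a parallel pair with a label in Z/2; labels add up under both
    compositions, which satisfies interchange because Z/2 is commutative, and
    all constraint cells have label 0. *)
Record lcell := LCell { lsrc : M; ltgt : M; label : bool; lparallel : parallel lsrc ltgt }.

Lemma lcell_eq (x y : lcell) : lsrc x = lsrc y -> ltgt x = ltgt y -> label x = label y -> x = y.
Proof.
case: x y => [f g b p] [f' g' b' p'] /= Ef Eg Eb; case: _ / Ef p'; case: _ / Eg; case: _ / Eb => p'.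
by rewrite (Prop_irrelevance p p').
Qed.

Definition lid (f : M) : lcell := @LCell f f false (fun=> erefl).

Definition lbd (e : side) (i : 'I_2) (x : lcell) : lcell :=
  lid (if i == i0 then bnd e (lsrc x) else if e is Src then lsrc x else ltgt x).

Lemma lid_inj f g : lid f = lid g -> f = g. Proof. by case. Qed.

Lemma lbd_idem d e i x : lbd d i (lbd e i x) = lbd e i x.
Proof. by case: (ordI2 i) => ->; case: d; rewrite /lbd /= ?bd_idem. Qed.

Lemma lbd_upper d e (i j : 'I_2) x : i < j -> lbd d j (lbd e i x) = lbd e i x.
Proof. by case: (ordI2 i) (ordI2 j) => -> [] -> // _; case: d. Qed.

Lemma lbd_lower d e (i j : 'I_2) x : i < j -> lbd e i (lbd d j x) = lbd e i x.
Proof.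
case: (ordI2 i) (ordI2 j) => -> [] -> // _; case: d => //.
by rewrite /lbd /= (lparallel x).
Qed.

Definition lgr : grCat 2 := GrCat lbd_idem lbd_upper lbd_lower.

(** With this junk value only the target of [lmk f g b] depends on [f] and [g]
    being parallel, so sources and labels of composites are computed without
    any side condition. *)
Definition lmk (f g : M) (b : bool) : lcell :=
  if pselect (parallel f g) is left fg then LCell b fg
  else @LCell f f b (fun=> erefl).

Lemma lsrc_lmk f g b : lsrc (lmk f g b) = f.
Proof. by rewrite /lmk; case: pselect. Qed.

Lemma label_lmk f g b : label (lmk f g b) = b.
Proof. by rewrite /lmk; case: pselect. Qed.

Lemma ltgt_lmk f g b : parallel f g -> ltgt (lmk f g b) = g.
Proof. by rewrite /lmk; case: pselect. Qed.

Definition lcomp (i : 'I_2) (a b : lgr) : lgr :=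
  if i == i0
  then lmk (comp ord0 (lsrc a) (lsrc b)) (comp ord0 (ltgt a) (ltgt b)) (label a (+) label b)
  else lmk (lsrc b) (ltgt a) (label a (+) label b).

Arguments lcomp : simpl never.

Lemma src0_lgr (a b : lgr) : src i0 a = tgt i0 b -> src ord0 (lsrc a) = tgt ord0 (lsrc b).
Proof. exact: lid_inj. Qed.

Lemma src0_lgr_lt (a b : lgr) : src i0 a = tgt i0 b -> src ord0 (ltgt a) = tgt ord0 (ltgt b).
Proof. by move/src0_lgr; rewrite !lparallel. Qed.

Lemma src1_lgr (a b : lgr) : src i1 a = tgt i1 b -> lsrc a = ltgt b.
Proof. exact: lid_inj. Qed.

Lemma lsrc_lcomp0 (a b : lgr) : lsrc (lcomp i0 a b) = comp ord0 (lsrc a) (lsrc b).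
Proof. exact: lsrc_lmk. Qed.

Lemma lsrc_lcomp1 (a b : lgr) : lsrc (lcomp i1 a b) = lsrc b.
Proof. exact: lsrc_lmk. Qed.

Lemma label_lcomp i (a b : lgr) : label (lcomp i a b) = label a (+) label b.
Proof. by case: (ordI2 i) => ->; apply: label_lmk. Qed.

Lemma ltgt_lcomp0 (a b : lgr) : src i0 a = tgt i0 b ->
  ltgt (lcomp i0 a b) = comp ord0 (ltgt a) (ltgt b).
Proof.
move=> ab; apply: ltgt_lmk => e; have := src0_lgr ab; have := src0_lgr_lt ab.
by case: e => *; rewrite ?comp_src ?comp_tgt // lparallel.
Qed.

Lemma ltgt_lcomp1 (a b : lgr) : src i1 a = tgt i1 b -> ltgt (lcomp i1 a b) = ltgt a.
Proof. by move=> /src1_lgr ab; apply: ltgt_lmk => e; rewrite lparallel -ab lparallel. Qed.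

Definition lcompE := (lsrc_lcomp0, lsrc_lcomp1, label_lcomp).

Lemma lcomp_src i (a b : lgr) : src i a = tgt i b -> src i (lcomp i a b) = src i b.
Proof.
case: (ordI2 i) => -> ab; apply: lcell_eq; rewrite //= lcompE //.
  by rewrite comp_src //; apply: src0_lgr.
by rewrite comp_src //; apply: src0_lgr.
Qed.

Lemma lcomp_tgt i (a b : lgr) : src i a = tgt i b -> tgt i (lcomp i a b) = tgt i a.
Proof.
case: (ordI2 i) => -> ab; apply: lcell_eq; rewrite //= ?ltgt_lcomp1 // lcompE //.
  by rewrite comp_tgt //; apply: src0_lgr.
by rewrite comp_tgt //; apply: src0_lgr.
Qed.

Lemma lcomp_bd e (i j : 'I_2) (a b : lgr) : i < j -> src i a = tgt i b ->
  bd e j (lcomp i a b) = lcomp i (bd e j a) (bd e j b).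
Proof.
case: (ordI2 i) (ordI2 j) => -> [] -> // _ ab.
have ab1 : src i0 (bd e i1 a : lgr) = tgt i0 (bd e i1 b : lgr) by rewrite !bd_lower.
apply: lcell_eq; rewrite ?label_lcomp ?lsrc_lcomp0 ?(ltgt_lcomp0 ab1) //=;
  by case: (e); rewrite ?(ltgt_lcomp0 ab) // lsrc_lcomp0.
Qed.

Definition lpre : preCat 2 := PreCat lcomp_src lcomp_tgt lcomp_bd.

Lemma lpre_iso2 (a : lpre) : is_iso2 a.
Proof.
pose b : lpre := LCell (label a) (fun e => esym (lparallel a e)).
have sb : src i1 b = tgt i1 a by [].
have tb : tgt i1 b = src i1 a by [].
by exists b; split=> //; apply: lcell_eq;
  rewrite /= ?(@ltgt_lcomp1 b a) ?(@ltgt_lcomp1 a b) // lcompE //= addbb.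
Qed.

Lemma is_mor1_lid (f : lpre) : is_mor i1 f -> lsrc f = ltgt f /\ label f = false.
Proof. by case=> y ->. Qed.

Definition lalpha (h g f : lpre) : lpre :=
  lmk (comp ord0 (comp ord0 (lsrc h) (lsrc g)) (lsrc f))
      (comp ord0 (lsrc h) (comp ord0 (lsrc g) (lsrc f))) false.
Definition llambda (f : lpre) : lpre :=
  lmk (comp ord0 (tgt ord0 (lsrc f)) (lsrc f)) (lsrc f) false.
Definition lrho (f : lpre) : lpre :=
  lmk (comp ord0 (lsrc f) (src ord0 (lsrc f))) (lsrc f) false.

Lemma ltgt_lalpha (h g f : lpre) : src i0 h = tgt i0 g -> src i0 g = tgt i0 f ->
  ltgt (lalpha h g f) = comp ord0 (lsrc h) (comp ord0 (lsrc g) (lsrc f)).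
Proof.
move=> /src0_lgr hg /src0_lgr gf; apply: ltgt_lmk.
by case; rewrite !(comp_src, comp_tgt) ?comp_src ?comp_tgt.
Qed.

Lemma ltgt_llambda (f : lpre) : ltgt (llambda f) = lsrc f.
Proof. by apply: ltgt_lmk; case; rewrite !(comp_src, comp_tgt) ?bd_idem. Qed.

Lemma ltgt_lrho (f : lpre) : ltgt (lrho f) = lsrc f.
Proof. by apply: ltgt_lmk; case; rewrite !(comp_src, comp_tgt) ?bd_idem. Qed.

Lemma lalpha_bd (h g f : lpre) :
    is_mor i1 h -> is_mor i1 g -> is_mor i1 f ->
    src i0 h = tgt i0 g -> src i0 g = tgt i0 f ->
  [/\ src i1 (lalpha h g f) = (h **0 g) **0 f,
      tgt i1 (lalpha h g f) = h **0 (g **0 f)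
    & is_iso2 (lalpha h g f)].
Proof.
move=> /is_mor1_lid[eh bh] /is_mor1_lid[eg bg] /is_mor1_lid[ef bf] hg gf.
have hg_f : src i0 (h **0 g) = tgt i0 f by rewrite comp_src.
have h_gf : src i0 h = tgt i0 (g **0 f) by rewrite comp_tgt.
split; last exact: lpre_iso2; apply: lcell_eq.
all: rewrite ?ltgt_lcomp0 // ?lcompE //= ?lsrc_lmk ?ltgt_lalpha -?eh -?eg -?ef ?bh ?bg ?bf //.
Qed.

Lemma lalpha_bd3 (h g f : lpre) : composable3 h g f ->
  [/\ src i1 (lalpha h g f) = (h **0 g) **0 f,
      tgt i1 (lalpha h g f) = h **0 (g **0 f)
    & is_iso2 (lalpha h g f)].
Proof. by case; apply: lalpha_bd. Qed.

Lemma llambda_bd (f : lpre) : is_mor i1 f ->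
  [/\ src i1 (llambda f) = tgt i0 f **0 f, tgt i1 (llambda f) = f
    & is_iso2 (llambda f)].
Proof.
move=> /is_mor1_lid[ef bf].
split; last exact: lpre_iso2; apply: lcell_eq;
  by rewrite ?ltgt_lcomp0 ?lcompE ?bd_idem //= ?lsrc_lmk ?ltgt_llambda -?ef ?bf.
Qed.

Lemma lrho_bd (f : lpre) : is_mor i1 f ->
  [/\ src i1 (lrho f) = f **0 src i0 f, tgt i1 (lrho f) = f
    & is_iso2 (lrho f)].
Proof.
move=> /is_mor1_lid[ef bf].
split; last exact: lpre_iso2; apply: lcell_eq;
  by rewrite ?ltgt_lcomp0 ?lcompE ?bd_idem //= ?lsrc_lmk ?ltgt_lrho -?ef ?bf.
Qed.

Lemma lcomp1A (a b c : lpre) : src i1 a = tgt i1 b -> src i1 b = tgt i1 c ->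
  (a **1 b) **1 c = a **1 (b **1 c).
Proof.
move=> ab bc; have ab_c : src i1 (a **1 b) = tgt i1 c by rewrite comp_src.
have a_bc : src i1 a = tgt i1 (b **1 c) by rewrite comp_tgt.
by apply: lcell_eq; rewrite ?(ltgt_lcomp1 ab_c, ltgt_lcomp1 a_bc, ltgt_lcomp1 ab) //
  !lcompE // addbA.
Qed.

Lemma lcomp1_src (a : lpre) : a **1 src i1 a = a.
Proof.
have c : src i1 a = tgt i1 (src i1 a) by rewrite bd_idem.
by apply: lcell_eq; rewrite ?(ltgt_lcomp1 c) // !lcompE //= addbF.
Qed.

Lemma lcomp1_tgt (a : lpre) : tgt i1 a **1 a = a.
Proof.
have c : src i1 (tgt i1 a) = tgt i1 a by rewrite bd_idem.
by apply: lcell_eq; rewrite ?(ltgt_lcomp1 c) // !lcompE.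
Qed.

Lemma linterchange (a b c d : lpre) :
    src i1 a = tgt i1 b -> src i1 c = tgt i1 d -> src i0 a = tgt i0 c ->
  (a **1 b) **0 (c **1 d) = (a **0 c) **1 (b **0 d).
Proof.
move=> ab cd ac; have [c0 bd0 c1] := interchange_composable ab cd ac.
apply: lcell_eq; last by rewrite !lcompE addbACA.
  by rewrite !lcompE.
by rewrite (ltgt_lcomp0 c0) (ltgt_lcomp1 c1) (ltgt_lcomp0 ac) (ltgt_lcomp1 ab) (ltgt_lcomp1 cd).
Qed.

Lemma lalpha_nat (c b a : lpre) : src i0 c = tgt i0 b -> src i0 b = tgt i0 a ->
  lalpha (tgt i1 c) (tgt i1 b) (tgt i1 a) **1 ((c **0 b) **0 a) =
  (c **0 (b **0 a)) **1 lalpha (src i1 c) (src i1 b) (src i1 a).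
Proof.
move=> cb ba; have [cT cS] := alpha_nat_composable lalpha_bd3 cb ba.
apply: lcell_eq.
- by rewrite !lcompE lsrc_lmk.
- rewrite (ltgt_lcomp1 cT) (ltgt_lcomp1 cS) ltgt_lalpha ?bd_lower //.
  have c_ba : src i0 c = tgt i0 (b **0 a) by rewrite comp_tgt.
  by rewrite (ltgt_lcomp0 c_ba) (ltgt_lcomp0 ba).
- by rewrite !lcompE !label_lmk addFb addbF addbA.
Qed.

Lemma llambda_nat (a : lpre) :
  llambda (tgt i1 a) **1 (tgt i0 a **0 a) = a **1 llambda (src i1 a).
Proof.
have [cT cS] := lambda_nat_composable llambda_bd a; apply: lcell_eq.
- by rewrite !lcompE lsrc_lmk.
- by rewrite (ltgt_lcomp1 cT) (ltgt_lcomp1 cS) ltgt_llambda.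
- by rewrite !lcompE !label_lmk addbF.
Qed.

Lemma lrho_nat (a : lpre) :
  lrho (tgt i1 a) **1 (a **0 src i0 a) = a **1 lrho (src i1 a).
Proof.
have [cT cS] := rho_nat_composable lrho_bd a; apply: lcell_eq.
- by rewrite !lcompE lsrc_lmk.
- by rewrite (ltgt_lcomp1 cT) (ltgt_lcomp1 cS) ltgt_lrho.
- by rewrite !lcompE !label_lmk addbF.
Qed.

Lemma lpentagon (k h g f : lpre) :
    is_mor i1 k -> is_mor i1 h -> is_mor i1 g -> is_mor i1 f ->
    src i0 k = tgt i0 h -> src i0 h = tgt i0 g -> src i0 g = tgt i0 f ->
  lalpha k h (g **0 f) **1 lalpha (k **0 h) g f =
  (k **0 lalpha h g f) **1 (lalpha k (h **0 g) f **1 (lalpha k h g **0 f)).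
Proof.
move=> mk mh mg mf kh hg gf.
have [[[_ _ _ c11 c12] c2] c4 [k3 s5f] c [c45 c345]] :=
  pentagon_composable lalpha_bd3 mk mh mg mf kh hg gf.
have [ek bk] := is_mor1_lid mk; have [_ bf] := is_mor1_lid mf.
apply: lcell_eq.
- by rewrite !lcompE !lsrc_lmk.
- rewrite (ltgt_lcomp1 c) (ltgt_lcomp1 c345) (ltgt_lcomp0 k3) !ltgt_lalpha //.
  by rewrite lcompE ek.
- by rewrite !lcompE !label_lmk bk bf.
Qed.

Lemma ltriangle (g f : lpre) : is_mor i1 g -> is_mor i1 f -> src i0 g = tgt i0 f ->
  (g **0 llambda f) **1 lalpha g (src i0 g) f = lrho g **0 f.
Proof.
move=> mg mf gf.
have [[_ _ _ gu uf] gL Rf LA] := triangle_composable lalpha_bd3 llambda_bd lrho_bd mg mf gf.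
have [eg bg] := is_mor1_lid mg; have [ef bf] := is_mor1_lid mf.
apply: lcell_eq.
- by rewrite !lcompE !lsrc_lmk.
- by rewrite (ltgt_lcomp1 LA) (ltgt_lcomp0 gL) (ltgt_lcomp0 Rf) ltgt_lrho ltgt_llambda eg ef.
- by rewrite !lcompE !label_lmk bg bf.
Qed.

Definition labelled : bicat :=
  Bicat lalpha_bd llambda_bd lrho_bd lcomp1A lcomp1_src lcomp1_tgt linterchange
    lalpha_nat llambda_nat lrho_nat lpentagon ltriangle.
End Labelled.

Section Separation.
Variables (X : genData) (P : gd2 X -> bool).

Notation C := (freePre1 (gd1 X)).

Definition label_gen (x : genGr X) : labelled C :=
  match x with
  | inl y => LCell (P y) (fun e => gd_glob e y)
  | inr c => lid c
  end.

Lemma label_gen_gr : is_gr_map label_gen.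
Proof. by move=> e i [y|c]; case: (ordI2 i) => ->; case: e. Qed.

Lemma label_gen_pre : @is_pre_map 2 (pre12 C) (labelled C) (label_gen \o @inC X).
Proof.
split=> [e i c|i c d]; first exact: (label_gen_gr e i (inr c)).
case: (ordI2 i) => -> cd.
  have cd' : src i0 (lid c : labelled C) = tgt i0 (lid d : labelled C).
    by apply: lcell_eq.
  by apply: lcell_eq; rewrite ?(ltgt_lcomp0 cd') ?lcompE.
have -> : d = c by [].
exact: (esym (comp1_src (lid c : labelled C))).
Qed.
End Separation.

Lemma iotaA_gr (X : genData) (A : bicat) (G0 : freePre2 X -> A) :
  is_pre_map G0 -> is_gr_map (iotaA G0).
Proof. by move=> [Gbd _] e i x; rewrite /iotaA /= gen_incl_gr Gbd. Qed.

(** Two generators identified in [A] are identified by every labelling.  A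
    2-cell is singled out by the labelling by equality with it, the labelling
    constantly 1 tells 2-cells from words, and words are their own sources. *)
Lemma iotaA_injective (X : genData) (A : bicat) (G0 : freePre2 X -> A) :
  is_generated G0 -> injective (iotaA G0).
Proof.
move=> [_ univ] x y xy.
have sep P : label_gen P x = label_gen P y.
  have [H [[_ HF] _]] := univ _ _ (extend_pre_map (label_gen_gr P) (label_gen_pre P)).
  by rewrite -[LHS](HF (gen_incl x)) -[RHS](HF (gen_incl y)) /= -[G0 _]/(iotaA G0 x) xy.
case: x y sep {xy} => [x|c] [y|d] sep.
- have /(congr1 (@label _)) /= := sep (fun z => `[<z = x>]).
  by rewrite asboolT // => /esym/asboolP ->.
- by have /(congr1 (@label _)) := sep predT.
- by have /(congr1 (@label _)) := sep predT.
- by have /lid_inj -> := sep predT.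
Qed.

(** Maps out of [A] are determined by their restriction to the free
    pre-2-category, hence by their restriction to the generators. *)
Lemma generated_universal (X : genData) (A : bicat) (G0 : freePre2 X -> A)
    (B : bicat) (iotaB : genGr X -> B) : is_generated G0 -> is_gr_map iotaB ->
  @is_pre_map 2 (pre12 (freePre1 (gd1 X))) B (iotaB \o @inC X) ->
  exists! F : A -> B, is_bicat_map F /\ iotaB =1 F \o iotaA G0.
Proof.
move=> [preG univ] Bbd Bpre; have preF := extend_pre_map Bbd Bpre.
have [H [[mapH HF] uniqH]] := univ _ _ preF.
exists H; split; first by split=> // x; rewrite -[LHS]/(extend iotaB (gen_incl x)) -HF.
move=> H' [mapH' EH']; apply: uniqH; split=> //.
have [[H'bd H'c] _ _ _] := mapH'.
apply: freePre2_map_unique preF _ => [|x]; last by rewrite [RHS]EH'.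
split=> [e i x|i x y xy] /=; first by rewrite preG.1 H'bd.
by rewrite preG.2 // H'c // -!preG.1 xy.
Qed.

(** * Presentations *)

Section Presentation.
Variable B : bicat.

Definition cell1 : Type := {x : B | src i1 x = x}.

Lemma cell1_bd_subproof e (x : cell1) : src i1 (bd e i0 (sval x)) = bd e i0 (sval x).
Proof. by rewrite bd_upper. Qed.

Definition cell1_bd e (i : 'I_1) (x : cell1) : cell1 :=
  exist _ (bd e i0 (sval x)) (cell1_bd_subproof e x).

Lemma cell1_idem d e i x : cell1_bd d i (cell1_bd e i x) = cell1_bd e i x.
Proof. by apply: eq_exist => /=; rewrite bd_idem. Qed.

Lemma cell1_upper d e (i j : 'I_1) x : i < j ->
  cell1_bd d j (cell1_bd e i x) = cell1_bd e i x.
Proof. by rewrite !ord1. Qed.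

Lemma cell1_lower d e (i j : 'I_1) x : i < j ->
  cell1_bd e i (cell1_bd d j x) = cell1_bd e i x.
Proof. by rewrite !ord1. Qed.

Definition cell1_gr : grCat 1 := GrCat cell1_idem cell1_upper cell1_lower.

Lemma cell1_eq (x y : cell1_gr) : sval x = sval y -> x = y.
Proof. by case: x y => [x px] [y py]; apply: eq_exist. Qed.

Definition word1 (x : cell1_gr) : freePre1 cell1_gr := exist _ (WGen x) I.

Definition bd1_cell (e : side) (x : B) : cell1_gr :=
  exist _ (bd e i1 x) (bd_idem Src e i1 x).

Lemma tautological_glob e (x : B) :
  bd e ord0 (word1 (bd1_cell Src x)) = bd e ord0 (word1 (bd1_cell Tgt x)).
Proof. by apply: eq_exist; congr WGen; apply: eq_exist; rewrite /= !bd_lower. Qed.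

(** Every cell [x] of [B] becomes a generating 2-cell between the one-letter words
    on its 1-boundaries; a 1-cell thus also gives a generating 2-cell besides the
    letter, and both evaluate to it. *)
Definition tautological : genData :=
  @GenData cell1_gr B (fun e x => word1 (bd1_cell e x)) tautological_glob.

Notation X := tautological.
Notation C := (freePre1 cell1_gr).

Fixpoint weval (w : word cell1_gr) : B :=
  match w with
  | WGen x => sval x
  | WBul x y => weval x **0 weval y
  end.

Lemma weval_bd0 e w : wwf w -> weval (wbd e w) = bd e i0 (weval w).
Proof.
elim: w e => //= x IHx y IHy e [wx wy xy].
have Exy : src i0 (weval x) = tgt i0 (weval y) by rewrite -IHx // xy IHy.
by case: e; rewrite ?comp_src ?comp_tgt // ?IHx ?IHy.
Qed.

Lemma weval_bd1 e w : wwf w -> bd e i1 (weval w) = weval w.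
Proof.
elim: w => [[x Ex]|x IHx y IHy] /= => [_|[wx wy xy]].
  by rewrite -Ex bd_idem.
by rewrite bd1_comp0 ?IHx ?IHy // -!weval_bd0 // xy.
Qed.

Definition tautological_eval (x : genGr X) : B :=
  match x with
  | inl y => y
  | inr c => weval (sval c)
  end.

Lemma tautological_eval_gr : is_gr_map tautological_eval.
Proof.
move=> e i [y|[c wc]]; case: (ordI2 i) => -> //=.
- by rewrite bd_lower.
- exact: weval_bd0.
- by rewrite weval_bd1.
Qed.

Lemma tautological_eval_pre :
  @is_pre_map 2 (pre12 C) B (tautological_eval \o @inC X).
Proof.
split=> [e i c|i c d]; first exact: (tautological_eval_gr e i (inr c)).
case: (ordI2 i) => -> cd.
  by rewrite /= /pre12_comp /= /cword_comp; case: pselect.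
have /= -> : d = c by [].
by rewrite -[LHS]comp1_src weval_bd1 //; apply: svalP.
Qed.

(** The evaluation [G] is the quotient by its own kernel.  A map [F] respecting
    the kernel descends to [F \o s], where [s b] is the generating 2-cell on [b]:
    equations for [F \o s] are obtained by comparing two cells of [A] with the
    same image under [G]. *)
Lemma tautological_presentation (A : bicat) (G0 : freePre2 X -> A) :
  is_generated G0 ->
  exists (R : A -> A -> Prop) (G : A -> B), is_quotient R G.
Proof.
move=> genG.
have [G [[mapG EG] _]] :=
  generated_universal genG tautological_eval_gr tautological_eval_pre.
have [[Gbd Gcomp] Galpha Glambda Grho] := mapG.
exists (fun x y => G x = G y), G; split=> // D F [[Fbd Fcomp] Falpha Flambda Frho] FG.
have {}FG x y : G x = G y -> F x = F y := FG x y.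
pose s (b : B) : A := iotaA G0 (inl b : genGr X).
pose t (x : cell1_gr) : A := iotaA G0 (inC (X := X) (word1 x)).
have Gs b : G (s b) = b by rewrite -[LHS]EG.
have Gt x : G (t x) = sval x by rewrite -[LHS]EG.
have iota_bd := iotaA_gr genG.1.
have t_eq x y : sval x = sval y -> t x = t y by move=> xy; congr t; apply: cell1_eq.
have bd1_s e b : bd e i1 (s b) = t (bd1_cell e b) by rewrite -iota_bd.
have bd0_t e x : bd e i0 (t x) = t (bd e ord0 x).
  by rewrite -iota_bd; congr iotaA; congr inr; apply: eq_exist.
have t_mor x : is_mor i1 (t x) by apply: is_mor1_bd; rewrite -iota_bd.
have s_composable i b c : src i b = tgt i c -> src i (s b) = tgt i (s c).
  case: (ordI2 i) => -> bc; last by rewrite !bd1_s; apply: t_eq.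
  rewrite -(bd_lower Src Src (i := i0) (j := i1)) // bd1_s bd0_t.
  rewrite -(bd_lower Src Tgt (i := i0) (j := i1)) // bd1_s bd0_t.
  by apply: t_eq; rewrite /= !bd_lower.
(* [s b] is not a 1-cell even if [b] is one, so the constraint cells are
   computed on the letters [u b], which have the same image under [F]. *)
pose u (b : B) := t (bd1_cell Src b).
have Gu b : is_mor i1 b -> G (u b) = b by move=> mb; rewrite Gt /= bd_is_mor1.
have u_composable b c : src i0 b = tgt i0 c -> src i0 (u b) = tgt i0 (u c).
  by move=> bc; rewrite !bd0_t; apply: t_eq; rewrite /= !bd_lower.
have Fsu b : is_mor i1 b -> F (s b) = F (u b) by move=> /Gu Gub; apply: FG; rewrite Gs.
exists (F \o s); split; last first.
  by move=> K [_ KG]; apply/funext => b /=; rewrite -KG /= Gs.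
split; last by move=> a /=; apply: FG; rewrite Gs.
split=> [|h g f mh mg mf hg gf|f mf|f mf] /=.
- split=> [e i b|i b c bc] /=.
    by rewrite -Fbd; apply: FG; rewrite Gbd !Gs.
  have sbc := s_composable _ _ _ bc.
  by rewrite -Fcomp //; apply: FG; rewrite Gcomp // !Gs.
- have uhg := u_composable _ _ hg; have ugf := u_composable _ _ gf.
  rewrite [in RHS]Fsu // [in RHS](Fsu g) // [in RHS](Fsu f) //.
  rewrite -Falpha //; try exact: t_mor.
  by apply: FG; rewrite Galpha ?Gu ?Gs //; exact: t_mor.
- rewrite [in RHS]Fsu // -Flambda; last exact: t_mor.
  by apply: FG; rewrite Glambda ?Gu ?Gs //; exact: t_mor.
- rewrite [in RHS]Fsu // -Frho; last exact: t_mor.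
  by apply: FG; rewrite Grho ?Gu ?Gs //; exact: t_mor.
Qed.
End Presentation.

Theorem corollary2p8 :
  (forall X : genData, exists (A : bicat) (G0 : freePre2 X -> A),
      is_generated G0) /\
  (forall (X : genData) (A : bicat) (G0 : freePre2 X -> A), is_generated G0 ->
    [/\ is_gr_map (iotaA G0), injective (iotaA G0)
      & forall (B : bicat) (iotaB : genGr X -> B),
          is_gr_map iotaB -> injective iotaB ->
          @is_pre_map 2 (pre12 (freePre1 (gd1 X))) B (iotaB \o @inC X) ->
          exists! F : A -> B, is_bicat_map F /\ iotaB =1 F \o iotaA G0]) /\
  (forall (X : genData) (A : bicat) (G0 : freePre2 X -> A), is_generated G0 ->
    forall C : A -> A -> Prop,
    exists (Q : bicat) (G : A -> Q), is_quotient C G) /\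
  (forall B : bicat,
    exists (X : genData) (A : bicat) (G0 : freePre2 X -> A), is_generated G0 /\
    exists (C : A -> A -> Prop) (Q : bicat) (G : A -> Q),
      is_quotient C G /\ bicat_iso B Q).
Proof.
split; first exact: generated_exists.
split; [|split].
- move=> X A G0 genG; split.
  + exact: iotaA_gr genG.1.
  + exact: iotaA_injective.
  + by move=> B iotaB Bbd _; apply: generated_universal.
- by move=> X A G0 _ C; apply: quotient_exists.
- move=> B; have [A [G0 genG]] := generated_exists (tautological B).
  exists (tautological B), A, G0; split=> //.
  have [R [G quotG]] := tautological_presentation genG.
  by exists R, B, G; split=> //; exists id, id; split.
Qed.
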